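(* Let $\mathsf D=\mathsf D^b(\mathrm{mod}\,\Lambda(r,n,m))$ with $n>r\ge 1$, $m\ge 0$, and let $C=C(m+r,n-r)$ with set of marked points $\ell$. There is an isomorphism of abelian groups $$K_0(\mathsf D)\cong H_1(C,\ell),$$ where $K_0(\mathsf D)$ is the Grothendieck group of the triangulated category $\mathsf D$ and $H_1(C,\ell)$ is the first relative singular homology group with integer coefficients.
   Context: Let $k$ be an algebraically closed field and let $n>r\ge 1$, $m\ge 0$ be integers. The algebra $\Lambda=\Lambda(r,n,m)=kQ/I$: $Q$ has vertices $-m,\dots,-1,0,1,\dots,n-1$, arrows $\alpha_i\colon i\to i+1$ for $-m\le i\le n-2$, and $\alpha_{n-1}\colon n-1\to 0$; $I$ is generated by the $r$ paths ''$\alpha_{n-1}$ followed by $\alpha_0$'' and ''$\alpha_j$ followed by $\alpha_{j+1}$'' for $n-r\le j\le n-2$. $\mathsf D=\mathsf D^b(\mathrm{mod}\,\Lambda)$. $C(p,q)\cong S^1\times[0,1]$ is the cylinder with $p$ marked points $x_1,\dots,x_p$ on the boundary circle $S^1\times\{0\}$ and $q$ marked points $y_1,\dots,y_q$ on the boundary circle $S^1\times\{1\}$; $\ell=\{x_1,\dots,x_p,y_1,\dots,y_q\}$. *)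

(* Defs.v *)
From HB Require Import structures.
From mathcomp Require Import all_boot all_order all_algebra.
From mathcomp Require Import generic_quotient ring_quotient zify.
From mathcomp Require Import freeg.
From mathcomp Require Import all_classical all_reals all_analysis.

Set Implicit Arguments.
Unset Strict Implicit.
Unset Printing Implicit Defensive.

Import Order.TTheory GRing.Theory Num.Theory.
Import numFieldNormedType.Exports.

Local Open Scope classical_set_scope.
Local Open Scope ring_scope.

(** * Quotients of abelian groups and of rings *)

Section GroupQuotient.
Variable G : zmodType.

Definition subgroup : set (set G) :=
  [set H | H 0 /\ forall x y, H x -> H y -> H (x - y)].

Definition gen_pred (S : set G) : {pred G} := fun x => `[< smallest subgroup S x >].

Lemma gen_closed S : zmod_closed (gen_pred S).
Proof.
split; first by apply/asboolP => H [[]].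
move=> x y /asboolP hx /asboolP hy; apply/asboolP => H HS.
by have [[_ HB] _] := HS; apply: HB; [apply: hx | apply: hy].
Qed.

HB.instance Definition _ S :=
  GRing.isZmodClosed.Build G (gen_pred S) (gen_closed S).

(** The quotient of [G] by the subgroup generated by [S]. *)
Definition zquot (S : set G) : zmodType := Quotient.quot (gen_pred S).

Definition zpi (S : set G) (x : G) : zquot S := (\pi_(zquot S) x)%qT.

Lemma zpi_is_zmod_morphism S : zmod_morphism (zpi S).
Proof. by move=> x y; rewrite /zpi raddfB. Qed.

HB.instance Definition _ S :=
  GRing.isZmodMorphism.Build G (zquot S) (zpi S) (zpi_is_zmod_morphism S).

Lemma zpi_eq S x y : smallest subgroup S (x - y) -> zpi S x = zpi S y.
Proof. by move=> h; apply/eqP; rewrite -Quotient.idealrBE; apply/asboolP. Qed.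

Lemma zpi_eqP S x y : zpi S x = zpi S y -> smallest subgroup S (x - y).
Proof. by move/eqP; rewrite -Quotient.idealrBE => /asboolP. Qed.

Lemma zpi_repr S (x : zquot S) : zpi S (repr x) = x.
Proof. exact: reprK. Qed.

End GroupQuotient.

Section QuotientMap.
Variables (G H : zmodType) (S : set G) (T : set H) (f : {additive G -> H}).
Hypothesis fST : forall x, S x -> smallest (@subgroup H) T (f x).

(** The map induced by [f]; the proof argument is what makes it well defined. *)
Definition zquot_map (_ : forall x, S x -> smallest (@subgroup H) T (f x))
  (x : zquot S) : zquot T := zpi T (f (repr x)).

Lemma gen_map x : smallest (@subgroup G) S x -> smallest (@subgroup H) T (f x).
Proof.
move=> Sx; apply: (Sx [set y | smallest (@subgroup H) T (f y)]); split => //.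
split; first by rewrite /= raddf0 => K [[]].
move=> u v /= Tu Tv; rewrite raddfB => K KT.
by have [[_ KB] _] := KT; apply: KB; [apply: Tu | apply: Tv].
Qed.

Lemma zquot_map_pi x : zquot_map fST (zpi S x) = zpi T (f x).
Proof.
apply: zpi_eq; rewrite -raddfB; apply: gen_map; apply: zpi_eqP.
exact: zpi_repr.
Qed.

Lemma zquot_map_is_zmod_morphism : zmod_morphism (zquot_map fST).
Proof.
by move=> x y; rewrite -(zpi_repr x) -(zpi_repr y) -raddfB !zquot_map_pi !raddfB.
Qed.

HB.instance Definition _ := GRing.isZmodMorphism.Build (zquot S) (zquot T)
  (zquot_map fST) zquot_map_is_zmod_morphism.

End QuotientMap.

Section Homology.
Variables (U V W : zmodType).

Definition ker_pred (g : {additive V -> W}) : {pred V} := fun x => g x == 0.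

Lemma ker_closed g : zmod_closed (ker_pred g).
Proof.
split=> [|x y]; rewrite !unfold_in ?raddf0 // => /eqP gx /eqP gy.
by rewrite raddfB /= gx gy subrr.
Qed.

HB.instance Definition _ g :=
  GRing.isZmodClosed.Build V (ker_pred g) (ker_closed g).

Record ker (g : {additive V -> W}) := Ker { ker_val : V; _ : ker_val \in ker_pred g }.

HB.instance Definition _ g := [isSub for @ker_val g].
HB.instance Definition _ g := [Choice of ker g by <:].
HB.instance Definition _ g := [SubChoice_isSubZmodule of ker g by <:].

(** The homology [ker g / im f] of [U --f--> V --g--> W]. *)
Definition homology (f : {additive U -> V}) (g : {additive V -> W}) : zmodType :=
  zquot [set z : ker g | exists u, ker_val z = f u].

End Homology.

Section RingQuotient.
Variable A : pzRingType.

Definition two_sided_ideal : set (set A) :=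
  [set J | [/\ J 0, (forall x y, J x -> J y -> J (x - y)) &
               (forall a x, J x -> J (a * x) /\ J (x * a))]].

Definition ideal_pred (S : set A) : {pred A} :=
  fun x => `[< smallest two_sided_ideal S x >].

Lemma ideal_closed S : zmod_closed (ideal_pred S).
Proof.
split; first by apply/asboolP => H [[]].
move=> x y /asboolP hx /asboolP hy; apply/asboolP => H HS.
by have [[_ HB _] _] := HS; apply: HB; [apply: hx | apply: hy].
Qed.

HB.instance Definition _ S :=
  GRing.isZmodClosed.Build A (ideal_pred S) (ideal_closed S).

Lemma idealMl S a x : x \in ideal_pred S -> a * x \in ideal_pred S.
Proof.
move=> /asboolP hx; apply/asboolP => H HS.
by have [[_ _ /(_ a x)HM] _] := HS; have [] := HM (hx _ HS).
Qed.

Lemma idealMr S a x : x \in ideal_pred S -> x * a \in ideal_pred S.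
Proof.
move=> /asboolP hx; apply/asboolP => H HS.
by have [[_ _ /(_ a x)HM] _] := HS; have [] := HM (hx _ HS).
Qed.

(** The quotient of [A] by the two-sided ideal generated by [S]. *)
Definition rquot (S : set A) : Type := Quotient.quot (ideal_pred S).

HB.instance Definition _ S := GRing.Zmodule.on (rquot S).

Definition rpi (S : set A) (x : A) : rquot S := (\pi_(Quotient.quot (ideal_pred S)) x)%qT.

Lemma rpi_is_zmod_morphism S : zmod_morphism (rpi S).
Proof. by move=> x y; rewrite /rpi raddfB. Qed.

HB.instance Definition _ S :=
  GRing.isZmodMorphism.Build A (rquot S) (rpi S) (rpi_is_zmod_morphism S).

Lemma rpi_eqP S x y : reflect (rpi S x = rpi S y) (x - y \in ideal_pred S).
Proof. by rewrite Quotient.idealrBE; apply: eqP. Qed.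

Lemma rpi_repr S (x : rquot S) : rpi S (repr (x : Quotient.quot _)) = x.
Proof. exact: reprK. Qed.

Definition rquot_mul S (x y : rquot S) : rquot S :=
  rpi S (repr (x : Quotient.quot _) * repr (y : Quotient.quot _)).

Lemma rpiM S x y : rpi S (x * y) = rquot_mul (rpi S x) (rpi S y).
Proof.
apply/rpi_eqP; set x' := repr _; set y' := repr _.
have hx : x - x' \in ideal_pred S by apply/rpi_eqP; rewrite rpi_repr.
have hy : y - y' \in ideal_pred S by apply/rpi_eqP; rewrite rpi_repr.
have -> : x * y - x' * y' = (x - x') * y + x' * (y - y').
  by rewrite mulrBl mulrBr addrA subrK.
by apply: rpredD; [exact: idealMr | exact: idealMl].
Qed.

Lemma rquot_ring S :
  [/\ associative (@rquot_mul S), left_id (rpi S 1) (@rquot_mul S),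
      right_id (rpi S 1) (@rquot_mul S),
      left_distributive (@rquot_mul S) +%R &
      right_distributive (@rquot_mul S) +%R].
Proof.
have surj (x : rquot S) : {x' | x = rpi S x'} by exists (repr x); rewrite rpi_repr.
split=> [x y z|x|x|x y z|x y z].
- have [[[x' ->] [y' ->]] [z' ->]] := (surj x, surj y, surj z).
  by rewrite -(rpiM S y') -(rpiM S x' y') -!rpiM mulrA.
- by have [x' ->] := surj x; rewrite -(rpiM S 1) mul1r.
- by have [x' ->] := surj x; rewrite -(rpiM S x') mulr1.
- have [[[x' ->] [y' ->]] [z' ->]] := (surj x, surj y, surj z).
  by rewrite -(rpiM S x') -(rpiM S y') -(raddfD (rpi S)) -rpiM mulrDl raddfD.
- have [[[x' ->] [y' ->]] [z' ->]] := (surj x, surj y, surj z).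
  by rewrite -(rpiM S x') -(rpiM S x') -(raddfD (rpi S)) -rpiM mulrDr raddfD.
Qed.

HB.instance Definition _ S := GRing.Zmodule_isPzRing.Build (rquot S)
  (let: And5 h _ _ _ _ := rquot_ring S in h)
  (let: And5 _ h _ _ _ := rquot_ring S in h)
  (let: And5 _ _ h _ _ := rquot_ring S in h)
  (let: And5 _ _ _ h _ := rquot_ring S in h)
  (let: And5 _ _ _ _ h := rquot_ring S in h).

Lemma rpi_is_monoid_morphism S : monoid_morphism (rpi S).
Proof. by split=> // x y; rewrite rpiM. Qed.

HB.instance Definition _ S :=
  GRing.isMonoidMorphism.Build A (rquot S) (rpi S) (rpi_is_monoid_morphism S).

End RingQuotient.

(** * Path algebras *)

Record quiver := Quiver {
  qvert : finType; qarr : finType; qsrc : qarr -> qvert; qtgt : qarr -> qvert }.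

Section PathAlgebra.
Variables (k : fieldType) (Q : quiver).

Fixpoint is_qpath (v : qvert Q) (s : seq (qarr Q)) : bool :=
  if s is a :: s' then (qsrc a == v) && is_qpath (qtgt a) s' else true.

(** A path is a starting vertex together with the arrows in the order in which
    they are followed; [(v, [::])] is the trivial path at [v]. *)
Record qpath := QPath { qpath_val : qvert Q * seq (qarr Q);
                        _ : is_qpath qpath_val.1 qpath_val.2 }.

HB.instance Definition _ := [isSub for qpath_val].
HB.instance Definition _ := [Choice of qpath by <:].

Definition qbeg (p : qpath) : qvert Q := (qpath_val p).1.
Definition qarrs (p : qpath) : seq (qarr Q) := (qpath_val p).2.
Definition qend (p : qpath) : qvert Q := last (qbeg p) (map (@qtgt Q) (qarrs p)).

Definition qtriv (v : qvert Q) : qpath := @QPath (v, [::]) isT.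

Lemma is_qpath1 (a : qarr Q) : is_qpath (qsrc a) [:: a].
Proof. by rewrite /= eqxx. Qed.

Definition qarrow (a : qarr Q) : qpath := @QPath (qsrc a, [:: a]) (is_qpath1 a).

Lemma is_qpath_cat v s t : is_qpath v (s ++ t) =
  is_qpath v s && is_qpath (last v (map (@qtgt Q) s)) t.
Proof. by elim: s v => //= a s IH v; rewrite IH andbA. Qed.

Definition path_alg : Type := {freeg qpath / k}.

HB.instance Definition _ := GRing.Lmodule.on path_alg.

Definition pelt (p : qpath) : path_alg := << p >>.

(** [p * q] is [p] followed by [q], and [0] if [q] does not start where [p]
    ends; when it does, the concatenation is a path and [insubd] returns it. *)
Definition pmul (p q : qpath) : path_alg :=
  if qend p == qbeg q then pelt (insubd p (qbeg p, qarrs p ++ qarrs q)) else 0.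

Definition palg_mul (x y : path_alg) : path_alg :=
  fglift (fun p => fglift (fun q => pmul p q : {freeg qpath / k}) y) x.

Definition palg_one : path_alg := \sum_(v : qvert Q) pelt (qtriv v).

Lemma fgliftD (M : lmodType k) (f : qpath -> M) (x y : {freeg qpath / k}) :
  fglift f (x + y) = fglift f x + fglift f y.
Proof.
have fB : zmod_morphism (fglift f) by apply: lift_is_additive.
pose g := GRing.isZmodMorphism.Build _ _ _ fB.
pose F : {additive {freeg qpath / k} -> M} := HB.pack (fglift f) g.
exact: (raddfD F).
Qed.

Lemma fgliftZ (M : lmodType k) (f : qpath -> M) c (x : {freeg qpath / k}) :
  fglift f (c *: x) = c *: fglift f x.
Proof.
have fB : zmod_morphism (fglift f) by apply: lift_is_additive.
pose g := GRing.isZmodMorphism.Build _ _ _ fB.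
pose F : {additive {freeg qpath / k} -> M} := HB.pack (fglift f) g.
have cE : c *: x = \sum_(p <- dom x) << c * coeff p x *g p >> by [].
change (F (c *: x) = c *: F x); rewrite cE raddf_sum.
rewrite -[in RHS](freeg_sumE x) raddf_sum scaler_sumr; apply: eq_bigr => p _.
by rewrite /F /= !liftU scalerA.
Qed.

Lemma palg_ind (P : path_alg -> Prop) :
  (forall x y, P x -> P y -> P (x + y)) -> (forall c x, P x -> P (c *: x)) ->
  (forall p, P (pelt p)) -> P 0 -> forall x, P x.
Proof.
move=> PD PZ P1 P0 x; have -> : x = \sum_(z <- dom x) coeff z x *: pelt z.
  rewrite -[LHS](freeg_sumE (x : {freeg qpath / k})); apply: eq_bigr => p _.
  by apply/eqP/freeg_eqP => q; rewrite coeffZ !coeffU mul1r.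
by elim/big_ind: _ => // p _; apply: PZ.
Qed.

Lemma palg_mulDl : left_distributive palg_mul +%R.
Proof. by move=> x y z; apply: (@fgliftD {freeg qpath / k} _ x y). Qed.

Lemma palg_mulZl c x y : palg_mul (c *: x) y = c *: palg_mul x y.
Proof. exact: fgliftZ. Qed.

Lemma palg_mul0l x : palg_mul 0 x = 0.
Proof. by have := palg_mulZl 0 0 x; rewrite !scale0r. Qed.

Lemma palg_mul1p p y : palg_mul (pelt p) y = fglift (fun q => pmul p q : {freeg qpath / k}) y.
Proof. by rewrite /palg_mul /pelt liftU scale1r. Qed.

Lemma palg_mulDr : right_distributive palg_mul +%R.
Proof.
move=> x y z; elim/palg_ind: x => [x1 x2 h1 h2|c x h|p|].
- by rewrite !palg_mulDl h1 h2 addrACA.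
- by rewrite !palg_mulZl h scalerDr.
- by rewrite !palg_mul1p; exact: fgliftD.
- by rewrite !palg_mul0l addr0.
Qed.

Lemma palg_mulZr c x y : palg_mul x (c *: y) = c *: palg_mul x y.
Proof.
elim/palg_ind: x => [x1 x2 h1 h2|d x h|p|].
- by rewrite !palg_mulDl h1 h2 scalerDr.
- by rewrite !palg_mulZl h !scalerA mulrC.
- by rewrite !palg_mul1p; exact: fgliftZ.
- by rewrite !palg_mul0l scaler0.
Qed.

Lemma palg_mul0r x : palg_mul x 0 = 0.
Proof. by have := palg_mulZr 0 x 0; rewrite !scale0r. Qed.

Lemma palg_mulpp p q : palg_mul (pelt p) (pelt q) = pmul p q.
Proof. by rewrite palg_mul1p /pelt liftU scale1r. Qed.

Lemma qcatK p q : qend p = qbeg q ->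
  qpath_val (insubd p (qbeg p, qarrs p ++ qarrs q)) = (qbeg p, qarrs p ++ qarrs q).
Proof.
move=> e; apply: insubdK; rewrite unfold_in /= is_qpath_cat.
move: e; rewrite /qend => ->; rewrite /qbeg /qarrs.
by case: p q => [[u s] /= ->] [[v t] /= ->].
Qed.

Lemma palg_mulA : associative palg_mul.
Proof.
move=> x y z; elim/palg_ind: x => [x1 x2 h1 h2|c x h|p|].
- by rewrite !palg_mulDl h1 h2.
- by rewrite !palg_mulZl h.
- elim/palg_ind: y => [x1 x2 h1 h2|c x h|q|].
  + by rewrite palg_mulDr !palg_mulDl palg_mulDr h1 h2.
  + by rewrite palg_mulZr !palg_mulZl palg_mulZr h.
  + elim/palg_ind: z => [x1 x2 h1 h2|c x h|r|].
    * by rewrite !palg_mulDr h1 h2.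
    * by rewrite !palg_mulZr h.
    * rewrite !palg_mulpp /pmul.
      have [e1|n1] := eqVneq (qend p) (qbeg q); last first.
        rewrite palg_mul0l; have [e2|n2] := eqVneq (qend q) (qbeg r); last first.
          by rewrite palg_mul0r.
        rewrite palg_mulpp /pmul {1}/qbeg (qcatK e2).
        by rewrite ifN.
      have e1' : qend (insubd p (qbeg p, qarrs p ++ qarrs q)) = qend q.
        rewrite /qend {1}/qbeg /qarrs (qcatK e1) /= map_cat last_cat.
        by move: e1; rewrite /qend => ->.
      rewrite [RHS]palg_mulpp /pmul e1'.
      have [e2|n2] := eqVneq (qend q) (qbeg r); last by rewrite palg_mul0r.
      rewrite palg_mulpp /pmul {1}/qbeg (qcatK e2) /= e1 eqxx.
      congr pelt; apply: val_inj => /=.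
      rewrite !qcatK ?e1' //; last by rewrite {1}/qbeg (qcatK e2) /= e1.
      by rewrite /qbeg /qarrs !qcatK //= catA.
    * by rewrite !palg_mul0r.
  + by rewrite palg_mul0r !palg_mul0l palg_mul0r.
- by rewrite !palg_mul0l.
Qed.

Lemma palg_mul_suml (I : Type) (s : seq I) (F : I -> path_alg) y :
  palg_mul (\sum_(i <- s) F i) y = \sum_(i <- s) palg_mul (F i) y.
Proof.
elim: s => [|i s IH]; first by rewrite !big_nil palg_mul0l.
by rewrite !big_cons palg_mulDl IH.
Qed.

Lemma palg_mul_sumr (I : Type) (s : seq I) (F : I -> path_alg) x :
  palg_mul x (\sum_(i <- s) F i) = \sum_(i <- s) palg_mul x (F i).
Proof.
elim: s => [|i s IH]; first by rewrite !big_nil palg_mul0r.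
by rewrite !big_cons palg_mulDr IH.
Qed.

Lemma palg_mul1l : left_id palg_one palg_mul.
Proof.
move=> x; elim/palg_ind: x => [x1 x2 h1 h2|c x h|p|].
- by rewrite palg_mulDr h1 h2.
- by rewrite palg_mulZr h.
- rewrite palg_mul_suml (bigD1 (qbeg p)) //= big1 => [|v nv]; rewrite palg_mulpp /pmul.
    rewrite eqxx addr0; congr pelt; apply: val_inj; rewrite /= qcatK //=.
    by rewrite /qbeg /qarrs; case: (qpath_val p).
  by rewrite ifN.
- by rewrite palg_mul0r.
Qed.

Lemma palg_mul1r : right_id palg_one palg_mul.
Proof.
move=> x; elim/palg_ind: x => [x1 x2 h1 h2|c x h|p|].
- by rewrite palg_mulDl h1 h2.
- by rewrite palg_mulZl h.
- rewrite palg_mul_sumr (bigD1 (qend p)) //= big1 => [|v nv]; rewrite palg_mulpp /pmul.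
    rewrite eqxx addr0; congr pelt; apply: val_inj; rewrite /= qcatK //= cats0.
    by rewrite /qbeg /qarrs; case: (qpath_val p).
  by rewrite ifN // eq_sym.
- by rewrite palg_mul0l.
Qed.

HB.instance Definition _ := GRing.Zmodule_isPzRing.Build path_alg
  palg_mulA palg_mul1l palg_mul1r palg_mulDl palg_mulDr.

Lemma palg_scaleAl c (x y : path_alg) : c *: (x * y) = (c *: x) * y.
Proof. exact/esym/palg_mulZl. Qed.

Lemma palg_scaleAr c (x y : path_alg) : c *: (x * y) = x * (c *: y).
Proof. exact/esym/palg_mulZr. Qed.

End PathAlgebra.

(** An (associative, unital) [k]-algebra: a ring with a ring morphism from [k]
    to its centre. The library's [algType] is not used since it requires
    [1 != 0]. *)
Record kalgebra (k : fieldType) := KAlgebra {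
  kalg_ring :> pzRingType;
  kalg_in : {rmorphism k -> kalg_ring};
  kalg_central : forall c x, kalg_in c * x = x * kalg_in c }.

Section QuiverAlgebra.
Variables (k : fieldType) (Q : quiver) (S : set (path_alg k Q)).

Definition qalg_in (c : k) : rquot S := rpi S (c *: (1 : path_alg k Q) : path_alg k Q).

Lemma qalg_in_is_zmod_morphism : zmod_morphism qalg_in.
Proof. by move=> c d; rewrite /qalg_in scalerBl raddfB. Qed.

HB.instance Definition _ :=
  GRing.isZmodMorphism.Build k (rquot S) qalg_in qalg_in_is_zmod_morphism.

Lemma qalg_in_is_monoid_morphism : monoid_morphism qalg_in.
Proof.
split=> [|c d]; rewrite /qalg_in ?scale1r ?rmorph1 // -rmorphM /=.
by rewrite -palg_scaleAl mul1r scalerA.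
Qed.

HB.instance Definition _ :=
  GRing.isMonoidMorphism.Build k (rquot S) qalg_in qalg_in_is_monoid_morphism.

Lemma qalg_central c (x : rquot S) : qalg_in c * x = x * qalg_in c.
Proof.
rewrite -(rpi_repr x) /qalg_in -!rmorphM; congr rpi.
by rewrite -palg_scaleAl -palg_scaleAr mul1r mulr1.
Qed.

(** The algebra [kQ/I], [I] the two-sided ideal generated by [S]. *)
Definition quiver_alg : kalgebra k := KAlgebra qalg_central.

End QuiverAlgebra.

Section Lambda.
Variables (k : fieldType) (r n m : nat).

(** The vertex [i], and the arrow [alpha_i] starting at it, [-m <= i <= n-1],
    are represented by the element [i + m] of ['I_(m + n)]; [label] recovers
    [i]. The default value of [insubd] is only used when [n = 0]. *)
Definition label (a : 'I_(m + n)) : int := a%:Z - m%:Z.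

Definition lambda_tgt (a : 'I_(m + n)) : 'I_(m + n) :=
  insubd a (if a.+1 == (m + n)%N then m else a.+1).

Definition lambda_quiver : quiver := @Quiver 'I_(m + n) 'I_(m + n) id lambda_tgt.

Definition alpha (a : 'I_(m + n)) : path_alg k lambda_quiver :=
  pelt k (@qarrow lambda_quiver a).

Definition lambda_relations : set (path_alg k lambda_quiver) :=
  [set x | exists a b, x = alpha a * alpha b /\
     ((label a = n%:Z - 1 /\ label b = 0) \/
      (n%:Z - r%:Z <= label a <= n%:Z - 2 /\ label b = label a + 1))].

Definition Lambda : kalgebra k := quiver_alg lambda_relations.

End Lambda.

(** * The bounded derived category of finite-dimensional modules *)

Section DerivedCategory.
Variables (k : fieldType) (A : kalgebra k).

(** A finite-dimensional right [A]-module, with underlying vector space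
    ['rV[k]_d]; [a] acts by [v |-> v *m fd_act a]. *)
Record fdmod := FdMod {
  fd_dim : nat;
  fd_act : {rmorphism A -> 'M[k]_fd_dim};
  fd_scal : forall c : k, fd_act (kalg_in A c) = c%:M }.

(** [f] represents the map [v |-> v *m f]; composites are therefore written in
    diagrammatic order. *)
Definition is_hom (M N : fdmod) (f : 'M[k]_(fd_dim M, fd_dim N)) : Prop :=
  forall a, fd_act M a *m f = f *m fd_act N a.

Section DirectSum.
Variables M N : fdmod.

Definition dsum_act (a : A) : 'M[k]_(fd_dim M + fd_dim N) :=
  block_mx (fd_act M a) 0 0 (fd_act N a).

Lemma dsum_act_is_zmod_morphism : zmod_morphism dsum_act.
Proof.
by move=> a b; rewrite /dsum_act opp_block_mx add_block_mx !raddfB !oppr0 !addr0.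
Qed.

Lemma dsum_act_is_monoid_morphism : monoid_morphism dsum_act.
Proof.
split=> [|a b]; first by rewrite /dsum_act !rmorph1 -scalar_mx_block.
rewrite /dsum_act !rmorphM /= -!mulmxE.
by rewrite mulmx_block !mulmx0 !mul0mx !addr0 !add0r.
Qed.

HB.instance Definition _ := GRing.isZmodMorphism.Build A
  'M[k]_(fd_dim M + fd_dim N) dsum_act dsum_act_is_zmod_morphism.
HB.instance Definition _ := GRing.isMonoidMorphism.Build A
  'M[k]_(fd_dim M + fd_dim N) dsum_act dsum_act_is_monoid_morphism.

Lemma dsum_scal c : dsum_act (kalg_in A c) = c%:M.
Proof. by rewrite /dsum_act !fd_scal -scalar_mx_block. Qed.

Definition dsum : fdmod := FdMod dsum_scal.

End DirectSum.

(** Bounded cochain complexes. *)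
Record cplx := Cplx {
  cx_mod :> int -> fdmod;
  cx_d : forall i, 'M[k]_(fd_dim (cx_mod i), fd_dim (cx_mod (i + 1)));
  cx_hom : forall i, is_hom (cx_d i);
  cx_dd : forall i, cx_d i *m cx_d (i + 1) = 0;
  cx_bdd : exists N : nat, forall i, (N < `|i|)%N -> fd_dim (cx_mod i) = 0%N }.

Record cmap (X Y : cplx) := CMap {
  cm_mx :> forall i, 'M[k]_(fd_dim (X i), fd_dim (Y i));
  cm_hom : forall i, is_hom (cm_mx i);
  cm_comm : forall i, cx_d X i *m cm_mx (i + 1) = cm_mx i *m cx_d Y i }.

Lemma cid_hom (X : cplx) i : is_hom (1%:M : 'M[k]_(fd_dim (X i))).
Proof. by move=> a; rewrite mulmx1 mul1mx. Qed.

Lemma cid_comm (X : cplx) i : cx_d X i *m 1%:M = 1%:M *m cx_d X i.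
Proof. by rewrite mulmx1 mul1mx. Qed.

Definition cid (X : cplx) : cmap X X := CMap (cid_hom X) (cid_comm X).

Section CComp.
Variables (X Y Z : cplx) (f : cmap X Y) (g : cmap Y Z).

Lemma ccomp_hom i : is_hom (f i *m g i).
Proof. by move=> a; rewrite mulmxA cm_hom -mulmxA cm_hom mulmxA. Qed.

Lemma ccomp_comm i : cx_d X i *m (f (i + 1) *m g (i + 1)) = f i *m g i *m cx_d Z i.
Proof. by rewrite mulmxA cm_comm -mulmxA cm_comm mulmxA. Qed.

Definition ccomp : cmap X Z := CMap ccomp_hom ccomp_comm.

End CComp.

(** [f] induces a bijection [H^(i+1)(X) -> H^(i+1)(Y)] for every [i : int]. *)
Definition qis (X Y : cplx) (f : cmap X Y) : Prop := forall i,
  (forall x : 'rV_(fd_dim (X (i + 1))), x *m cx_d X (i + 1) = 0 ->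
     (exists y, x *m f (i + 1) = y *m cx_d Y i) ->
     exists x', x = x' *m cx_d X i) /\
  (forall y : 'rV_(fd_dim (Y (i + 1))), y *m cx_d Y (i + 1) = 0 ->
     exists2 x, x *m cx_d X (i + 1) = 0 &
     exists y', x *m f (i + 1) - y = y' *m cx_d Y i).

Section Shift.
Variable X : cplx.

Lemma shift_hom i : @is_hom (X (i + 1)) (X (i + 1 + 1)) (- cx_d X (i + 1)).
Proof. by move=> a; rewrite mulmxN mulNmx cx_hom. Qed.

Lemma shift_dd i : (- cx_d X (i + 1)) *m (- cx_d X (i + 1 + 1)) = 0.
Proof. by rewrite mulmxN mulNmx opprK cx_dd. Qed.

Lemma shift_bdd :
  exists N : nat, forall i : int, (N < `|i|)%N -> fd_dim (X (i + 1)) = 0%N.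
Proof. by have [N hN] := cx_bdd X; exists N.+1 => i hi; apply: hN; lia. Qed.

(** [X[1]]. *)
Definition shift : cplx :=
  @Cplx (fun i => X (i + 1)) (fun i => - cx_d X (i + 1)) shift_hom shift_dd shift_bdd.

End Shift.

Section ShiftMap.
Variables (X Y : cplx) (f : cmap X Y).

Lemma shift_map_comm i : cx_d (shift X) i *m f (i + 1 + 1) = f (i + 1) *m cx_d (shift Y) i.
Proof. by rewrite /= mulNmx mulmxN cm_comm. Qed.

Definition shift_map : cmap (shift X) (shift Y) :=
  @CMap (shift X) (shift Y) (fun i => f (i + 1)) (fun i => cm_hom f (i + 1)) shift_map_comm.

Lemma shift_qis : qis f -> qis shift_map.
Proof.
move=> hf i; have [inj surj] := hf (i + 1); split=> /= [x dx [y fx]|y dy].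
- have [||x' ->] := inj x.
  + by move: dx; rewrite mulmxN => /eqP; rewrite oppr_eq0 => /eqP.
  + by exists (- y); rewrite fx mulmxN mulNmx.
  + by exists (- x'); rewrite mulmxN mulNmx opprK.
- have [|x dx [y' fx]] := surj y.
    by move: dy; rewrite mulmxN => /eqP; rewrite oppr_eq0 => /eqP.
  by exists x; [rewrite mulmxN dx oppr0 | exists (- y'); rewrite fx mulmxN mulNmx opprK].
Qed.

End ShiftMap.

Section Cone.
Variables (X Y : cplx) (f : cmap X Y).

Definition cone_mod (i : int) : fdmod := dsum (X (i + 1)) (Y i).

Definition cone_d (i : int) : 'M[k]_(fd_dim (cone_mod i), fd_dim (cone_mod (i + 1))) :=
  block_mx (- cx_d X (i + 1)) (f (i + 1)) 0 (cx_d Y i).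

Lemma cone_hom i : is_hom (cone_d i).
Proof.
move=> a; rewrite /cone_d /= /dsum_act !mulmx_block.
by rewrite !mul0mx !mulmx0 !addr0 !add0r mulmxN mulNmx !cx_hom cm_hom.
Qed.

Lemma cone_dd i : cone_d i *m cone_d (i + 1) = 0.
Proof.
rewrite /cone_d mulmx_block !mul0mx !mulmx0 !addr0 !add0r !mulNmx mulmxN !cx_dd.
by rewrite !oppr0 cm_comm addNr -block_mx0.
Qed.

Lemma cone_bdd : exists N : nat, forall i, (N < `|i|)%N -> fd_dim (cone_mod i) = 0%N.
Proof.
have [[N hN] [P hP]] := (cx_bdd X, cx_bdd Y); exists (N + P).+1 => i hi /=.
by rewrite hN ?hP //; lia.
Qed.

Definition cone : cplx := Cplx cone_hom cone_dd cone_bdd.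

Lemma cone_in_hom i : @is_hom (Y i) (cone i) (row_mx 0 1%:M).
Proof.
move=> a; rewrite /= /dsum_act mul_mx_row mul_row_block.
by rewrite !mul0mx !mulmx0 mulmx1 mul1mx !add0r.
Qed.

Lemma cone_in_comm i :
  cx_d Y i *m row_mx 0 1%:M = row_mx 0 1%:M *m cx_d cone i.
Proof.
rewrite /= /cone_d mul_mx_row mul_row_block.
by rewrite !mul0mx !mulmx0 mulmx1 mul1mx !add0r.
Qed.

Definition cone_in : cmap Y cone :=
  @CMap Y cone (fun i => row_mx 0 1%:M) cone_in_hom cone_in_comm.

Lemma cone_out_hom i : @is_hom (cone i) (shift X i) (col_mx 1%:M 0).
Proof.
move=> a; apply: etrans (mul_block_col _ _ _ _ _ _) _; rewrite mul_col_mx.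
by rewrite !mul0mx !mulmx0 mulmx1 mul1mx !addr0.
Qed.

Lemma cone_out_comm i :
  cx_d cone i *m col_mx 1%:M 0 = col_mx 1%:M 0 *m cx_d (shift X) i.
Proof.
apply: etrans (mul_block_col _ _ _ _ _ _) _; rewrite mul_col_mx.
by rewrite !mul0mx !mulmx0 mulmx1 mul1mx !addr0.
Qed.

Definition cone_out : cmap cone (shift X) :=
  @CMap cone (shift X) (fun i => col_mx 1%:M 0) cone_out_hom cone_out_comm.

End Cone.

(** [D^b(mod A)] is the localisation of the category of bounded complexes at
    the quasi-isomorphisms: its morphisms are the formal composites [dhom] of
    chain maps and formal inverses of quasi-isomorphisms, modulo [deq]. *)
Inductive dhom : cplx -> cplx -> Type :=
| Dloc X Y (f : cmap X Y) : dhom X Y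
| Dinv X Y (s : cmap X Y) (qs : qis s) : dhom Y X
| Dcomp X Y Z (u : dhom X Y) (v : dhom Y Z) : dhom X Z.

Inductive deq : forall X Y, dhom X Y -> dhom X Y -> Prop :=
| deq_refl X Y (u : dhom X Y) : deq u u
| deq_sym X Y (u v : dhom X Y) : deq u v -> deq v u
| deq_trans X Y (u v w : dhom X Y) : deq u v -> deq v w -> deq u w
| deq_comp X Y Z (u u' : dhom X Y) (v v' : dhom Y Z) :
    deq u u' -> deq v v' -> deq (Dcomp u v) (Dcomp u' v')
| deq_assoc X Y Z W (u : dhom X Y) (v : dhom Y Z) (w : dhom Z W) :
    deq (Dcomp u (Dcomp v w)) (Dcomp (Dcomp u v) w)
| deq_idl X Y (u : dhom X Y) : deq (Dcomp (Dloc (cid X)) u) u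
| deq_idr X Y (u : dhom X Y) : deq (Dcomp u (Dloc (cid Y))) u
| deq_loc X Y Z (f : cmap X Y) (g : cmap Y Z) :
    deq (Dcomp (Dloc f) (Dloc g)) (Dloc (ccomp f g))
| deq_invr X Y (s : cmap X Y) (qs : qis s) :
    deq (Dcomp (Dloc s) (Dinv qs)) (Dloc (cid X))
| deq_invl X Y (s : cmap X Y) (qs : qis s) :
    deq (Dcomp (Dinv qs) (Dloc s)) (Dloc (cid Y)).

Fixpoint dshift X Y (u : dhom X Y) : dhom (shift X) (shift Y) :=
  match u with
  | Dloc _ _ f => Dloc (shift_map f)
  | Dinv _ _ _ qs => Dinv (shift_qis qs)
  | Dcomp _ _ _ u v => Dcomp (dshift u) (dshift v)
  end.

Definition diso X Y (u : dhom X Y) : Prop :=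
  exists v : dhom Y X, deq (Dcomp u v) (Dloc (cid X)) /\ deq (Dcomp v u) (Dloc (cid Y)).

(** The triangles [X --u--> Y --v--> Z --w--> X[1]] isomorphic in [D^b(mod A)]
    to a mapping cone triangle. *)
Definition distinguished X Y Z (u : dhom X Y) (v : dhom Y Z) (w : dhom Z (shift X)) :=
  exists X' Y' (f : cmap X' Y') (a : dhom X' X) (b : dhom Y' Y) (c : dhom (cone f) Z),
    [/\ diso a, diso b & diso c] /\
    [/\ deq (Dcomp (Dloc f) b) (Dcomp a u),
        deq (Dcomp (Dloc (cone_in f)) c) (Dcomp b v) &
        deq (Dcomp (Dloc (cone_out f)) (dshift a)) (Dcomp c w)].

(** [K_0(D^b(mod A))]. That isomorphic objects have the same class follows from
    the triangles [X -> Y -> 0 -> X[1]]. *)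
Definition K0_Db : zmodType :=
  zquot [set x : {freeg {classic cplx} / int} |
    exists (X Y Z : {classic cplx}) (u : dhom X Y) (v : dhom Y Z) (w : dhom Z (shift X)),
      distinguished u v w /\ x = << X >> - << Y >> + << Z >>].

End DerivedCategory.

(** * Relative singular homology *)

Section SingularHomology.
Variable R : realType.

Definition stdsimplex (n : nat) : set 'rV[R]_n.+1 :=
  [set t | (forall i, 0 <= t 0 i) /\ \sum_i t 0 i = 1].
Arguments stdsimplex : clear implicits.

Definition face_fun (n : nat) (i : 'I_n.+2) (t : 'rV[R]_n.+1) : 'rV[R]_n.+2 :=
  \row_j oapp (fun j' => t 0 j') 0 (unlift i j).

Lemma face_simplex n i t : stdsimplex n t -> stdsimplex n.+1 (face_fun i t).
Proof.
move=> [t0 t1]; split=> [j|]; first by rewrite mxE; case: unlift => /=.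
rewrite (bigD1_ord i) //= mxE unlift_none add0r -[RHS]t1.
by apply: eq_bigr => j _; rewrite mxE liftK.
Qed.

Definition face_map n (i : 'I_n.+2) (t : stdsimplex n) : stdsimplex n.+1 :=
  exist _ (face_fun i (val t)) (mem_set (face_simplex i (set_mem (valP t)))).

Lemma face_map_continuous n i : continuous (@face_map n i).
Proof.
apply: continuous_comp_initial => t /=.
have ct : continuous (fun t : stdsimplex n => face_fun i (val t)); last exact: ct.
move=> {}t B [P Pn PB].
change (nbhs t [set s : stdsimplex n | B (face_fun i (val s))]).
suff : nbhs t [set s : stdsimplex n | forall j k, P j k (face_fun i (val s) j k)].
  by apply: filterS => s Ps; apply: PB => j k; apply: Ps.
apply: (@filter_forall _ _ (fun j => [set s : stdsimplex n |
  forall k, P j k (face_fun i (val s) j k)]) (nbhs t)) => j.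
apply: (@filter_forall _ _ (fun k => [set s : stdsimplex n |
  P j k (face_fun i (val s) j k)]) (nbhs t)) => k.
have := Pn j k; rewrite /= mxE.
case E: (unlift i k) => [k'|] /= Pk.
  have ct : {for t, continuous (@set_val _ (stdsimplex n))}.
    exact: initial_continuous.
  have := @continuous_comp _ _ _ (@set_val _ (stdsimplex n))
    (fun M : 'rV[R]_n.+1 => M 0 k') t ct (@coord_continuous _ _ _ 0 k' _).
  move=> /(_ _ Pk) h; change (nbhs t [set s : stdsimplex n | P j k ((set_val s : 'rV_n.+1) 0 k')]) in h.
  by apply: filterS h => s; rewrite /= /face_fun mxE E.
by apply: nearW => s; rewrite /= /face_fun mxE E /=; apply: nbhs_singleton.
Qed.

HB.instance Definition _ n i :=
  isContinuous.Build _ _ (@face_map n i) (@face_map_continuous n i).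

Section Relative.
Variables (X : topologicalType) (A : set X).

Definition simplex (n : nat) : choiceType := continuousType (stdsimplex n) X.

Definition face n (i : 'I_n.+2) (s : simplex n.+1) : simplex n := s \o face_map i.

Definition chain (n : nat) : zmodType := {freeg (simplex n) / int}.

Definition bd_simplex n (s : simplex n.+1) : {freeg (simplex n) / int} :=
  \sum_(i < n.+2) (-1) ^+ i *: << face i s >>.

Definition bd n (c : chain n.+1) : chain n := fglift (@bd_simplex n) c.

Lemma bd_is_zmod_morphism n : zmod_morphism (@bd n).
Proof. exact: lift_is_additive. Qed.

HB.instance Definition _ n :=
  GRing.isZmodMorphism.Build (chain n.+1) (chain n) (@bd n) (@bd_is_zmod_morphism n).

(** Generators of the subgroup [C_n(A)] of [C_n(X)]. *)
Definition sub_simplices n : set (chain n) :=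
  [set c | exists s : simplex n, range s `<=` A /\ c = << s >>].

Lemma bd_sub_simplices n c :
  @sub_simplices n.+1 c -> smallest (@subgroup (chain n)) (@sub_simplices n) (bd c).
Proof.
move=> [s [sA ->]] H [[H0 HB] HS].
have HN y : H y -> H (- y) by move=> Hy; rewrite -sub0r; apply: HB.
have HD y z : H y -> H z -> H (y + z).
  by move=> Hy Hz; rewrite -[z]opprK; apply: HB => //; apply: HN.
rewrite /bd liftU scale1r; apply: (big_ind H) => // i _.
have Hi : H << face i s >>.
  by apply: HS; exists (face i s); split=> // _ [t _ <-]; apply: sA; exists (face_map i t).
by rewrite -signr_odd; case: odd; rewrite ?expr0 ?expr1 ?scaleN1r ?scale1r //; apply: HN.
Qed.

Definition rel_chain n : zmodType := zquot (@sub_simplices n).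

Definition rel_bd n : {additive rel_chain n.+1 -> rel_chain n} :=
  zquot_map (@bd_sub_simplices n).

(** [H_(n+1)(X, A)]. *)
Definition rel_homologyS n : zmodType := homology (rel_bd n.+1) (rel_bd n).

End Relative.

(** * The cylinder *)

Definition circle : set (R * R) := [set z | z.1 ^+ 2 + z.2 ^+ 2 = 1].
Arguments circle : clear implicits.

Definition cylinder : topologicalType := (circle * `[0%R, 1%R : R]%classic)%type.

(** The points [x i] on [S^1 x {0}] and [y j] on [S^1 x {1}]. *)
Definition marked (p q : nat) (x : 'I_p -> circle) (y : 'I_q -> circle) : set cylinder :=
  [set c | (exists i, c.1 = x i /\ val c.2 = 0) \/
           (exists j, c.1 = y j /\ val c.2 = 1)].

End SingularHomology.

Arguments rel_homologyS R [X] A n.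
Arguments circle R _ : clear implicits.
Arguments stdsimplex R n _ : clear implicits.

(* Main.v *)
Require Import Defs.
From HB Require Import structures.
From mathcomp Require Import all_boot all_order all_algebra.
From mathcomp Require Import generic_quotient ring_quotient zify ring lra.
From mathcomp Require Import freeg.
From mathcomp Require Import all_classical all_reals all_analysis.

Set Implicit Arguments.
Unset Strict Implicit.
Unset Printing Implicit Defensive.

Import Order.TTheory GRing.Theory Num.Theory.
Import numFieldNormedType.Exports.

Local Open Scope classical_set_scope.
Local Open Scope ring_scope.

(** Both groups are free abelian of rank [m + n]; the isomorphism is obtained by
    computing each of them.

    On the algebraic side, the classes of the simple modules at the [m + n]
    vertices, placed in degree 0, form a basis. They generate: a nonzero
    finite-dimensional module contains a vector on which Lambda acts through the
    character of some vertex ([ex_eigenvector]), since every vertex of the quiver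
    has a single outgoing arrow and following the arrows ends at the zero path
    alpha_(n-1) alpha_0. Applied to the highest nonzero term of a complex, this
    gives a one-dimensional stalk inside the complex; the quotient is
    quasi-isomorphic to the cone of the inclusion ([quo_map_qis]), so induction on
    the total dimension writes every class as a combination of shifted simple
    modules ([spanned_class]). They are independent: for an idempotent [e] of the
    algebra, the alternating sum of the ranks of [e] on the terms of a complex is the
    alternating sum of the dimensions of the [e]-parts of its cohomology.
    Cohomology is a functor on the derived category ([dmap_deq]), so this number
    depends only on the isomorphism class, and it is additive on triangles
    ([euler_distinguished]). For the idempotents of the vertices its values on the
    simple modules form the identity matrix ([euler_simple]).

    On the topological side, the plane covers the cylinder (heights outside [0, 1]
    being pushed to the boundary). A path lifts to the plane ([lift_simplex]) and
    is there homotopic to the segment with the same ends ([straighten]); hence,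
    modulo boundaries, a 1-chain is determined by its own boundary and by its
    total winding number ([chain_clsE]). Winding is counted against a fixed,
    discontinuous, section of the covering, which makes it an integer even for
    paths that are not closed. If the marked points are [l 0], ..., [l N], a
    relative 1-cycle modulo relative boundaries is therefore determined by its
    winding number and by the multiplicities of [l 1], ..., [l N] in its boundary,
    the multiplicity of [l 0] being forced because the total degree is 0. All
    values occur ([h1_invariant_bij]), and [N + 1 = (m + r) + (n - r) = m + n]. *)

(** * Free abelian groups and quotients *)

Section FreeLift.
Variables (K : choiceType) (G : zmodType) (f : K -> G).

(** The universal property of [{freeg K / int}] for abelian groups: [fglift]
    needs a module over [int] as target, which the alias [ssrint.zmodule] of [G] is. *)
Definition zlift (c : {freeg K / int}) : G := fglift (f : K -> ssrint.zmodule G) c.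

Lemma zlift_is_zmod_morphism : zmod_morphism zlift.
Proof. exact: (@lift_is_additive int K (ssrint.zmodule G) f). Qed.

HB.instance Definition _ := GRing.isZmodMorphism.Build {freeg K / int} G
  zlift zlift_is_zmod_morphism.

Lemma zliftU x : zlift << x >> = f x.
Proof. by rewrite /zlift liftU scale1r. Qed.

End FreeLift.

Arguments zlift : simpl never.

Lemma freeg_ind_int (K : choiceType) (P : {freeg K / int} -> Prop) :
  P 0 -> (forall x y, P x -> P y -> P (x - y)) -> (forall x, P << x >>) ->
  forall c, P c.
Proof.
move=> P0 PB P1 c.
have PN x : P x -> P (- x) by move=> ?; rewrite -sub0r; apply: PB.
have PD x y : P x -> P y -> P (x + y) by move=> ? ?; rewrite -[y]opprK; apply/PB/PN.
rewrite -(freeg_sumE c); apply: (big_ind P) => // z _.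
have PM n : P (<< z >> *+ n).
  by elim: n => [|n IH]; [rewrite mulr0n | rewrite mulrS; apply: PD].
rewrite -[coeff z c]intz -freegU_mulz.
by case: (coeff z c) => n; rewrite ?NegzE ?mulrNz; [| apply: PN]; apply: PM.
Qed.

Lemma smallest_subgroup_ind (G : zmodType) (S : set G) (P : G -> Prop) :
  P 0 -> (forall x y, P x -> P y -> P (x - y)) -> (forall x, S x -> P x) ->
  forall x, smallest (@subgroup G) S x -> P x.
Proof. by move=> P0 PB PS x /(_ [set y | P y]); apply; split. Qed.

Lemma smallest_subgroup_ker (G H : zmodType) (S : set G)
    (f : {additive G -> H}) :
  (forall x, S x -> f x = 0) ->
  forall x, smallest (@subgroup G) S x -> f x = 0.
Proof.
move=> fS; apply: smallest_subgroup_ind => [|x y fx fy|//]; first exact: raddf0.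
by rewrite raddfB fx fy subrr.
Qed.

Section QuotientLift.
Variables (G H : zmodType) (S : set G) (f : {additive G -> H}).
Hypothesis fS : forall x, S x -> f x = 0.

(** The hypothesis is an argument so that the additive structure, which depends
    on it, can be attached to the function. *)
Definition zquot_lift (_ : forall x, S x -> f x = 0) (x : zquot S) : H := f (repr x).

Lemma zquot_lift_pi x : zquot_lift fS (zpi S x) = f x.
Proof.
apply/eqP; rewrite -subr_eq0 /zquot_lift -raddfB; apply/eqP.
by apply: smallest_subgroup_ker fS _ _; apply: zpi_eqP; rewrite zpi_repr.
Qed.

Lemma zquot_lift_is_zmod_morphism : zmod_morphism (zquot_lift fS).
Proof.
by move=> x y; rewrite -(zpi_repr x) -(zpi_repr y) -raddfB !zquot_lift_pi raddfB.
Qed.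

HB.instance Definition _ := GRing.isZmodMorphism.Build (zquot S) H
  (zquot_lift fS) zquot_lift_is_zmod_morphism.

End QuotientLift.

Arguments zquot_lift : simpl never.

Lemma zpi0 (G : zmodType) (S : set G) x : S x -> zpi S x = 0.
Proof.
move=> Sx; rewrite -(raddf0 (zpi S)); apply: zpi_eq; rewrite subr0.
by move=> H [_]; apply.
Qed.

Lemma bij_inj_surj (T U : Type) (f : T -> U) :
  injective f -> (forall y, exists x, f x = y) -> bijective f.
Proof.
move=> fi /choice [g gK]; exists g => // x; exact/fi/gK.
Qed.

Lemma additive_inj (G H : zmodType) (f : {additive G -> H}) :
  (forall x, f x = 0 -> x = 0) -> injective f.
Proof.
move=> f0 x y /eqP; rewrite -subr_eq0 -raddfB => /eqP/f0/eqP.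
by rewrite subr_eq0 => /eqP.
Qed.

(** * Characters of the path algebra and eigenvectors in its modules *)

Section RingQuotientLift.
Variables (A B : pzRingType) (S : set A) (f : {rmorphism A -> B}).
Hypothesis fS : forall x, S x -> f x = 0.

Lemma ideal_pred_ker x : x \in ideal_pred S -> f x = 0.
Proof.
move=> /asboolP /(_ [set y | f y = 0]); apply; split=> //.
split=> /= [|u v fu fv|a u fu]; first exact: rmorph0.
  by rewrite rmorphB fu fv subrr.
by rewrite !rmorphM fu mulr0 mul0r.
Qed.

Definition rquot_lift (_ : forall x, S x -> f x = 0) (x : rquot S) : B :=
  f (repr (x : Quotient.quot _)).

Lemma rquot_lift_pi x : rquot_lift fS (rpi S x) = f x.
Proof.
apply/eqP; rewrite -subr_eq0 -rmorphB; apply/eqP/ideal_pred_ker/rpi_eqP.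
exact: rpi_repr.
Qed.

Lemma rquot_lift_is_zmod_morphism : zmod_morphism (rquot_lift fS).
Proof.
by move=> x y; rewrite -(rpi_repr x) -(rpi_repr y) -rmorphB !rquot_lift_pi rmorphB.
Qed.

Lemma rquot_lift_is_monoid_morphism : monoid_morphism (rquot_lift fS).
Proof.
split=> [|x y]; first by rewrite -(rmorph1 (rpi S)) rquot_lift_pi rmorph1.
by rewrite -(rpi_repr x) -(rpi_repr y) -rmorphM !rquot_lift_pi rmorphM.
Qed.

HB.instance Definition _ := GRing.isZmodMorphism.Build (rquot S) B
  (rquot_lift fS) rquot_lift_is_zmod_morphism.
HB.instance Definition _ := GRing.isMonoidMorphism.Build (rquot S) B
  (rquot_lift fS) rquot_lift_is_monoid_morphism.

End RingQuotientLift.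

Section VertexCharacter.
Variables (k : fieldType) (Q : quiver).
Implicit Types (p q : qpath Q) (v w : qvert Q).

Lemma pelt_cat s p q : qpath_val s = (qbeg p, qarrs p ++ qarrs q) ->
  qend p = qbeg q -> pelt k p * pelt k q = pelt k s :> path_alg k Q.
Proof.
move=> sE e; rewrite -[LHS]/(palg_mul _ _) palg_mulpp /pmul e eqxx; congr pelt.
by apply: val_inj; rewrite /= qcatK // sE.
Qed.

Lemma pelt_mul0 p q : qend p != qbeg q -> pelt k p * pelt k q = 0 :> path_alg k Q.
Proof. by move=> /negPf e; rewrite -[LHS]/(palg_mul _ _) palg_mulpp /pmul e. Qed.

Definition vchar (v : qvert Q) (x : path_alg k Q) : k := coeff (qtriv v) x.

Lemma vchar_pelt v p : vchar v (pelt k p) = (p == qtriv v)%:R.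
Proof. by rewrite /vchar /pelt coeffU mul1r. Qed.

Lemma vchar_is_zmod_morphism v : zmod_morphism (vchar v).
Proof. by move=> x y; rewrite /vchar -[LHS]/(coeff _ (_ - _ : {freeg _ / k})) raddfB. Qed.

HB.instance Definition _ v := GRing.isZmodMorphism.Build (path_alg k Q) k
  (vchar v) (vchar_is_zmod_morphism v).

Lemma vcharZ v c (x : path_alg k Q) : vchar v (c *: x) = c * vchar v x.
Proof. exact: coeffZ. Qed.

Lemma vchar_is_monoid_morphism v : monoid_morphism (vchar v).
Proof.
split.
  rewrite -[1]/(palg_one k Q) /palg_one raddf_sum (bigD1 v) //= big1 => [|w wv].
    by rewrite vchar_pelt eqxx addr0.
  by rewrite vchar_pelt -val_eqE /= xpair_eqE (negPf wv).
move=> x y; elim/palg_ind: x => [x1 x2 h1 h2|c x h|p|].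
- by rewrite mulrDl !raddfD /= h1 h2 mulrDl.
- by rewrite -palg_scaleAl !vcharZ h mulrA.
- elim/palg_ind: y => [x1 x2 h1 h2|c x h|q|].
  + by rewrite mulrDr !raddfD /= h1 h2 mulrDr.
  + by rewrite -palg_scaleAr !vcharZ h mulrCA.
  + rewrite -[_ * _ in LHS]/(palg_mul _ _) palg_mulpp /pmul !vchar_pelt.
    case: eqP => [e|e]; last first.
      rewrite raddf0; case: eqP => [pv|]; last by rewrite mul0r.
      case: eqP => [qv|]; last by rewrite mulr0.
      by case: e; rewrite pv qv.
    rewrite vchar_pelt -natrM mulnb; congr (_ %:R); congr nat_of_bool.
    rewrite -!val_eqE /= qcatK //.
    case: p q e => [[pb pa] pP] [[qb qa] qP]; rewrite /qend /qbeg /qarrs /=.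
    rewrite !xpair_eqE; case: pa pP => [|a pa] pP //= e; last by rewrite !andbF.
    by rewrite e andbT; case: (qb == v).
  + by rewrite mulr0 !raddf0 mulr0.
- by rewrite mul0r !raddf0 mul0r.
Qed.

HB.instance Definition _ v := GRing.isMonoidMorphism.Build (path_alg k Q) k
  (vchar v) (vchar_is_monoid_morphism v).

End VertexCharacter.

Arguments pelt_cat k [Q] s [p q].
Section LambdaCharacters.
Variables (k : fieldType) (r n m : nat).
Let Q := lambda_quiver n m.
Let rel := @lambda_relations k r n m.
Let L := Lambda k r n m.

Lemma vchar_alpha (v a : 'I_(m + n)) : @vchar k Q v (alpha k a) = 0.
Proof. by rewrite vchar_pelt -val_eqE /= xpair_eqE andbF. Qed.

Lemma vchar_relations (v : 'I_(m + n)) x : rel x -> @vchar k Q v x = 0.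
Proof. by move=> [a [b [-> _]]]; rewrite rmorphM /= !vchar_alpha mulr0. Qed.

Definition lchar (v : 'I_(m + n)) : {rmorphism L -> k} :=
  rquot_lift (@vchar_relations v).

Lemma lchar_pi v (x : path_alg k Q) : lchar v (rpi rel x) = @vchar k Q v x.
Proof. exact: rquot_lift_pi. Qed.

Lemma lchar_scal v c : lchar v (kalg_in L c) = c.
Proof. by rewrite -[LHS]/(lchar v (rpi rel _)) lchar_pi vcharZ rmorph1 mulr1. Qed.

Definition idem (v : 'I_(m + n)) : L := rpi rel (pelt k (qtriv (v : qvert Q))).

Lemma idem_idem v : idem v * idem v = idem v.
Proof. by rewrite /idem -[LHS]rmorphM (pelt_cat k (qtriv (v : qvert Q))). Qed.

Lemma idem_orth v w : v != w -> idem v * idem w = 0.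
Proof. by move=> vw; rewrite /idem -[LHS]rmorphM pelt_mul0 ?rmorph0. Qed.

Lemma sum_idem : \sum_v idem v = 1.
Proof. by rewrite /idem -[RHS](rmorph1 (rpi rel)) -[LHS]rmorph_sum. Qed.

Lemma lchar_idem v w : lchar v (idem w) = (w == v)%:R.
Proof. by rewrite lchar_pi vchar_pelt -val_eqE /= xpair_eqE andbT. Qed.

Definition larrow (v : 'I_(m + n)) : L := rpi rel (alpha k v).

Lemma larrow_idem v : larrow v * idem (lambda_tgt v) = larrow v.
Proof.
rewrite /idem /larrow -[LHS]rmorphM; congr rpi.
by rewrite (pelt_cat k (@qarrow Q v)).
Qed.

Lemma larrow_last (v w : 'I_(m + n)) : v = (m + n).-1 :> nat -> w = m :> nat ->
  larrow v * larrow w = 0.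
Proof.
move=> vE wE; rewrite /larrow -[LHS]rmorphM -(rmorph0 (rpi rel)).
apply/rpi_eqP; rewrite subr0; apply/asboolP => H [_]; apply.
exists v, w; split=> //; left; rewrite /label vE wE.
by have := ltn_ord w; rewrite wE; split; lia.
Qed.

Section Eigenvector.
Variable M : fdmod L.

Lemma fd_actZ c (x : path_alg k Q) :
  fd_act M (rpi rel (c *: x)) = c *: fd_act M (rpi rel x).
Proof.
have -> : rpi rel (c *: x) = kalg_in L c * rpi rel x.
  by rewrite -[x in LHS]mul1r palg_scaleAl; exact: (rmorphM (rpi rel)).
by rewrite rmorphM fd_scal -mulmxE mul_scalar_mx.
Qed.

Lemma fd_actM (a b : L) : fd_act M (a * b) = fd_act M a *m fd_act M b.
Proof. by rewrite rmorphM mulmxE. Qed.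

(** A path other than the trivial one at [v] either starts at another vertex, and
    then kills [x] because [x] is fixed by the idempotent at [v], or starts with the
    unique arrow leaving [v], which kills [x] by assumption. *)
Lemma eigenvector_criterion v (x : 'rV[k]_(fd_dim M)) :
  x *m fd_act M (idem v) = x -> x *m fd_act M (larrow v) = 0 ->
  forall a, x *m fd_act M a = lchar v a *: x.
Proof.
move=> xv xa a; rewrite -(rpi_repr a) [lchar v _]lchar_pi; move: (repr _) => {}a.
elim/palg_ind: a => [a b ha hb|c a ha|p|].
- rewrite (rmorphD (rpi rel)) (rmorphD (fd_act M)) mulmxDr ha hb -scalerDl.
  by rewrite -(raddfD (@vchar k Q v)).
- by rewrite fd_actZ -scalemxAr ha scalerA vcharZ.
- rewrite vchar_pelt; have [e|ne] := eqVneq (qbeg p) v; last first.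
    have -> : pelt k p = pelt k (qtriv (qbeg p)) * pelt k p.
      by rewrite (pelt_cat k (p)) //; case: (p) => [[]].
    rewrite -{1}xv rmorphM -mulmxA -fd_actM mulrA [idem v * _]idem_orth 1?eq_sym //.
    rewrite mul0r rmorph0 mulmx0; have [pv|_] := eqVneq p; last by rewrite scale0r.
    by case/eqP: ne; rewrite pv.
  case: p e => [[u [|a s]] pP] /= e; rewrite /qbeg /= in e; subst u.
    rewrite -val_eqE /= eqxx scale1r.
    by rewrite (_ : QPath _ = qtriv (v : qvert Q)) //; apply: val_inj.
  have /andP[/eqP /= av sP] := pP; subst a.
  pose q := @QPath Q (lambda_tgt v, s) sP.
  rewrite -val_eqE /= xpair_eqE andbF scale0r.
  have <- : pelt k (@qarrow Q v) * pelt k q = pelt k (QPath pP).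
    by rewrite (pelt_cat k (QPath pP)).
  by rewrite rmorphM fd_actM mulmxA [X in X *m _]xa mul0mx.
- by rewrite !rmorph0 mulmx0 scale0r.
Qed.

Lemma lambda_tgtE (v : 'I_(m + n)) : (0 < n)%N ->
  lambda_tgt v = (if v.+1 == (m + n)%N then m else v.+1) :> nat.
Proof.
move=> n0; have vn := ltn_ord v.
have lt : ((if v.+1 == m + n then m else v.+1) < m + n)%N.
  case: eqP => [_|e]; first by rewrite -[X in (X < _)%N]addn0 ltn_add2l.
  by rewrite ltn_neqAle vn andbT; apply/eqP.
by rewrite /lambda_tgt (insubdK v lt).
Qed.

(** Push [x] along the arrows. Either some arrow kills it, or it reaches the last
    vertex; one more arrow leads to vertex 0 (index [m]), where the next arrow
    kills it by the relation alpha_(n-1) alpha_0 = 0. *)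
Lemma walk_eigenvector (v : 'I_(m + n)) (x : 'rV[k]_(fd_dim M)) : (0 < n)%N ->
  x != 0 -> x *m fd_act M (idem v) = x ->
  exists w (y : 'rV_(fd_dim M)),
    y != 0 /\ forall a, y *m fd_act M a = lchar w a *: y.
Proof.
move=> n0; have [j] := ubnP ((m + n).-1 - v)%N.
elim: j v x => // j IH v x vj x0 xv.
have [xa|xa] := eqVneq (x *m fd_act M (larrow v)) 0.
  by exists v, x; split=> //; apply: eigenvector_criterion.
have yv : x *m fd_act M (larrow v) *m fd_act M (idem (lambda_tgt v)) =
    x *m fd_act M (larrow v) by rewrite -mulmxA -fd_actM larrow_idem.
have := lambda_tgtE v n0; have vn := ltn_ord v; case: ifP => /eqP e tE; last first.
  by apply: IH xa yv; rewrite tE; lia.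
exists (lambda_tgt v), (x *m fd_act M (larrow v)); split=> //.
apply: eigenvector_criterion => //; rewrite -mulmxA -fd_actM larrow_last //.
  by rewrite rmorph0 mulmx0.
exact: (congr1 predn e).
Qed.

Lemma ex_eigenvector : (0 < n)%N -> fd_dim M <> 0%N ->
  exists w (y : 'rV_(fd_dim M)),
    y != 0 /\ forall a, y *m fd_act M a = lchar w a *: y.
Proof.
move=> n0 M0; have [v Ev] : exists v, fd_act M (idem v) != 0.
  apply/existsP; rewrite -[X in is_true X]negbK negb_exists.
  apply/negP => /forallP /= E0; have : (1%:M : 'M[k]_(fd_dim M)) != 0.
    by case: (fd_dim M) M0 => // d _; rewrite matrix_nonzero1.
  have <- : fd_act M 1 = 1%:M by rewrite rmorph1.
  rewrite -sum_idem rmorph_sum big1 ?eqxx // => v _.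
  by apply/eqP; have := E0 v; rewrite negbK.
have /rowV0Pn[x xE x0] := Ev; have /submxP[y yE] := xE.
by apply: (@walk_eigenvector v x) => //; rewrite yE -mulmxA -fd_actM idem_idem.
Qed.

End Eigenvector.
End LambdaCharacters.

(** * Classes of cones and of quotient complexes *)

Lemma mx_cols0 (F : pzRingType) (p q : nat) (x y : 'M[F]_(p, q)) : q = 0%N -> x = y.
Proof. by move=> q0; subst q; rewrite (thinmx0 x) (thinmx0 y). Qed.

(** The quotient map by the row space of [f]. It is locked, like its section
    [csec], because both unfold to products of matrices, on which rewriting with
    associativity would act. *)
HB.lock Definition cproj (k : fieldType) (e d : nat) (f : 'M[k]_(e, d)) :
  'M[k]_(d, \rank (cokermx f)) := col_base (cokermx f).

HB.lock Definition csec (k : fieldType) (e d : nat) (f : 'M[k]_(e, d)) :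
  'M[k]_(\rank (cokermx f), d) := pinvmx (cproj f).

Section CokernelMatrix.
Variables (k : fieldType) (e d : nat) (f : 'M[k]_(e, d)).

Lemma csecK : csec f *m cproj f = 1%:M.
Proof. by rewrite csec.unlock cproj.unlock; apply: mulVpmx; apply: col_base_full. Qed.

Lemma cproj_eq0 p (z : 'M[k]_(p, d)) : (z *m cproj f == 0) = (z <= f)%MS.
Proof.
rewrite submxE cproj.unlock -[in RHS](mulmx_base (cokermx f)) mulmxA.
by rewrite (mulmx_free_eq0 _ (row_base_free _)).
Qed.

Lemma mul_cproj : f *m cproj f = 0.
Proof. by apply/eqP; rewrite cproj_eq0. Qed.

Lemma cproj_inj p (u v : 'M[k]_(_, p)) : cproj f *m u = cproj f *m v -> u = v.
Proof. by move/(congr1 (mulmx (csec f))); rewrite !mulmxA csecK !mul1mx. Qed.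

End CokernelMatrix.

(** A map that sends the row space of [f] into that of [f'] descends to the
    quotients: [cproj f *m csec f] is the identity modulo [f]. *)
Lemma cproj_comm (k : fieldType) e d e' d' (f : 'M[k]_(e, d)) (f' : 'M[k]_(e', d'))
    (T : 'M[k]_(d, d')) :
  (f *m T <= f')%MS -> cproj f *m (csec f *m T *m cproj f') = T *m cproj f'.
Proof.
move=> fT; apply/eqP; rewrite -subr_eq0 !mulmxA -mulmxBl -{2}[T]mul1mx -mulmxBl.
rewrite cproj_eq0; have : (cproj f *m csec f - 1%:M <= f)%MS.
  by rewrite -cproj_eq0 mulmxBl mul1mx -mulmxA csecK mulmx1 subrr.
by case/submxP => w ->; rewrite -mulmxA; apply: mulmx_sub.
Qed.

Section Triangles.
Variables (k : fieldType) (A : kalgebra k).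
Implicit Types X Y Z : cplx A.

Definition K0_class X : K0_Db A := zpi _ (<< (X : {classic cplx A}) >> : {freeg _ / int}).

Lemma diso_qis X Y (s : cmap X Y) : qis s -> diso (Dloc s).
Proof. by move=> qs; exists (Dinv qs); split; constructor. Qed.

Lemma diso_cid X : diso (Dloc (Defs.cid X)).
Proof. by exists (Dloc (Defs.cid X)); split; apply: deq_idl. Qed.

Lemma shift_map_cid X : shift_map (Defs.cid X) = Defs.cid (Defs.shift X).
Proof. by rewrite /shift_map /Defs.cid; congr CMap; apply: Prop_irrelevance. Qed.

(** The third vertex of a cone triangle may be replaced by any complex that the
    cone maps to by a quasi-isomorphism. *)
Lemma K0_class_cone X Y Z (f : cmap X Y) (s : cmap (cone f) Z) :
  qis s -> K0_class Z = K0_class Y - K0_class X.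
Proof.
move=> qs; apply/eqP; rewrite -subr_eq0 opprB /K0_class -raddfB -raddfD; apply/eqP/zpi0.
exists X, Y, Z, (Dloc f), (Dcomp (Dloc (cone_in f)) (Dloc s)),
  (Dcomp (Dinv qs) (Dloc (cone_out f))); split; last by rewrite addrC.
exists X, Y, f, (Dloc (Defs.cid X)), (Dloc (Defs.cid Y)), (Dloc s); split.
  by split; [exact: diso_cid | exact: diso_cid | exact: diso_qis].
split.
- by apply: deq_trans (deq_idr _) _; apply: deq_sym; apply: deq_idl.
- by apply: deq_sym; apply: deq_idl.
- rewrite /= shift_map_cid; apply: deq_trans (deq_idr _) _; apply: deq_sym.
  apply: deq_trans (deq_assoc _ _ _) _.
  apply: deq_trans (deq_comp (deq_invr qs) (deq_refl _)) _; exact: deq_idl.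
Qed.

Lemma zero_hom (M N : fdmod A) : is_hom (0 : 'M[k]_(fd_dim M, fd_dim N)).
Proof. by move=> a; rewrite mulmx0 mul0mx. Qed.

Lemma zero_comm X Y i : cx_d X i *m (0 : 'M[k]_(_, fd_dim (Y (i + 1)))) =
  (0 : 'M[k]_(fd_dim (X i), _)) *m cx_d Y i.
Proof. by rewrite mulmx0 mul0mx. Qed.

Definition zero_map X Y : cmap X Y :=
  CMap (fun i => @zero_hom (X i) (Y i)) (@zero_comm X Y).

Lemma qis_bij X Y (f : cmap X Y) :
  (forall i, row_free (f i)) -> (forall i, row_full (f i)) -> qis f.
Proof.
move=> ff fF i.
have inv j : exists p, p *m f j = 1%:M by exists (pinvmx (f j)); apply: mulVpmx.
split=> [x dx [y fx]|y dy].
  have [p pf] := inv i; exists (y *m p); apply: (row_free_inj (ff (i + 1))) => /=.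
  by rewrite -!mulmxA (cm_comm f i) (mulmxA p) pf mul1mx.
have [q qf] := inv (i + 1); have e : y *m q *m f (i + 1) = y by rewrite -mulmxA qf mulmx1.
exists (y *m q); last by exists 0; rewrite e mul0mx subrr.
apply: (row_free_inj (ff (i + 1 + 1))).
by rewrite /= -!mulmxA (cm_comm f (i + 1)) (mulmxA q) qf mul1mx dy mul0mx.
Qed.

Lemma K0_class_zero Z : (forall i, fd_dim (Z i) = 0%N) -> K0_class Z = 0.
Proof.
move=> Z0; rewrite (@K0_class_cone Z Z Z (Defs.cid Z) (zero_map _ _)) ?subrr //.
apply: qis_bij => i; rewrite /row_free /row_full /= mxrank0 ?Z0 //.
Qed.

Section Quotient.
Variables (E X : cplx A) (f : cmap E X).
Hypothesis f_free : forall i, row_free (f i).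

Local Notation C i := (cproj (f i)).

Definition quo_act i (a : A) : 'M[k]_(\rank (cokermx (f i))) :=
  csec (f i) *m fd_act (X i) a *m cproj (f i).

Lemma quo_actE i a : C i *m quo_act i a = fd_act (X i) a *m C i.
Proof. by apply: cproj_comm; rewrite -cm_hom submxMl. Qed.

Lemma quo_act_is_zmod_morphism i : zmod_morphism (quo_act i).
Proof. by move=> a b; rewrite /quo_act raddfB mulmxBr mulmxBl. Qed.

Lemma quo_act_is_monoid_morphism i : monoid_morphism (quo_act i).
Proof.
split=> [|a b]; first by rewrite /quo_act rmorph1 mulmx1 csecK.
apply: (@cproj_inj _ _ _ (f i)); rewrite quo_actE rmorphM -!mulmxE.
by rewrite -mulmxA -quo_actE (mulmxA (fd_act _ _)) -quo_actE; apply/esym/mulmxA.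
Qed.

HB.instance Definition _ i := GRing.isZmodMorphism.Build A
  'M[k]_(\rank (cokermx (f i))) (quo_act i) (@quo_act_is_zmod_morphism i).
HB.instance Definition _ i := GRing.isMonoidMorphism.Build A
  'M[k]_(\rank (cokermx (f i))) (quo_act i) (@quo_act_is_monoid_morphism i).

Lemma quo_scal i c : quo_act i (kalg_in A c) = c%:M.
Proof.
by rewrite /quo_act fd_scal mul_mx_scalar -scalemxAl csecK scalemx1.
Qed.

Definition quo_mod i : fdmod A := FdMod (@quo_scal i).

Definition quo_d i : 'M[k]_(fd_dim (quo_mod i), fd_dim (quo_mod (i + 1))) :=
  csec (f i) *m cx_d X i *m cproj (f (i + 1)).

Lemma quo_dE i : C i *m quo_d i = cx_d X i *m C (i + 1).
Proof. by apply: cproj_comm; rewrite -cm_comm submxMl. Qed.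

Lemma quo_hom i : is_hom (quo_d i).
Proof.
move=> a; apply: (@cproj_inj _ _ _ (f i)).
change (C i *m (quo_act i a *m quo_d i) = C i *m (quo_d i *m quo_act (i + 1) a)).
rewrite (mulmxA (C i) (quo_act i a)) quo_actE -(mulmxA _ (C i)) quo_dE.
rewrite (mulmxA (C i) (quo_d i)) quo_dE -(mulmxA _ (C (i + 1))) quo_actE.
by rewrite mulmxA -(@cx_hom _ _ X i a) mulmxA.
Qed.

Lemma quo_dd i : quo_d i *m quo_d (i + 1) = 0.
Proof.
apply: (@cproj_inj _ _ _ (f i)).
rewrite (mulmxA (C i) (quo_d i)) quo_dE -(mulmxA _ (C (i + 1))) quo_dE.
by rewrite mulmxA cx_dd mul0mx mulmx0.
Qed.

Lemma quo_bdd : exists N : nat, forall i, (N < `|i|)%N -> fd_dim (quo_mod i) = 0%N.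
Proof.
have [N hN] := cx_bdd X; exists N => i /hN e /=; apply/eqP.
by rewrite -leqn0 -[in leqRHS]e rank_leq_row.
Qed.

Definition quo : cplx A := Cplx quo_hom quo_dd quo_bdd.

Lemma quo_dim i : (fd_dim (quo i) = fd_dim (X i) - fd_dim (E i))%N.
Proof. by rewrite /= mxrank_coker (eqP (f_free i)). Qed.

Definition quo_map_mx i : 'M[k]_(fd_dim (cone f i), fd_dim (quo i)) := col_mx 0 (C i).

Lemma quo_map_hom i : @is_hom _ _ (cone f i) (quo i) (quo_map_mx i).
Proof.
move=> a; rewrite /= /dsum_act /quo_map_mx.
rewrite [LHS]mul_block_col [RHS]mul_col_mx !mul0mx !mulmx0 !add0r.
by rewrite quo_actE.
Qed.

Lemma quo_map_comm i :
  cx_d (cone f) i *m quo_map_mx (i + 1) = quo_map_mx i *m cx_d quo i.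
Proof.
rewrite /= /cone_d /quo_map_mx [LHS]mul_block_col [RHS]mul_col_mx.
by rewrite !mul0mx !mulmx0 !add0r mul_cproj quo_dE.
Qed.

Definition quo_map : cmap (cone f) quo := CMap quo_map_hom quo_map_comm.

(** For an injective chain map the cone computes the cokernel: this is the long
    exact sequence of a short exact sequence of complexes, done by a chase. *)
Lemma quo_map_qis : qis quo_map.
Proof.
move=> i; split=> [x|y dy].
  rewrite -(hsubmxK x); move: (lsubmx x) (rsubmx x) => {x} e x.
  rewrite [LHS in LHS = _ -> _]mul_row_block mulmx0 addr0 -[0]row_mx0.
  case/eq_row_mx; rewrite mulmxN => /eqP; rewrite oppr_eq0 => /eqP de ex [y].
  rewrite [LHS]mul_row_col mulmx0 add0r => xy.
  pose y' := y *m csec (f i).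
  have yE : y = y' *m C i by rewrite -mulmxA csecK mulmx1.
  have : (x - y' *m cx_d X i <= f (i + 1)%R)%MS.
    by rewrite -cproj_eq0 mulmxBl [x *m _]xy yE -!mulmxA quo_dE subrr.
  case/submxP => w wE; exists (row_mx w y'); rewrite [RHS]mul_row_block mulmx0 addr0.
  congr row_mx; last by rewrite -wE subrK.
  apply: (row_free_inj (f_free (i + 1 + 1))).
  (* [x = w f + y' d], and [f] is injective, so [e = - w d]: hence [(e, x)] is the
     coboundary of [(w, y')]. *)
  have xE : x = w *m f (i + 1) + y' *m cx_d X i by rewrite -wE subrK.
  move/eqP: ex; rewrite addr_eq0 => /eqP -> /=.
  rewrite xE mulmxDl -!mulmxA (cx_dd X i) !mulmx0 addr0.
  by rewrite mulNmx mulmxN (cm_comm f (i + 1)).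
(* A lift [x] of [y] has [x d = w f] for some [w]; [(- w, x)] is the cocycle sought. *)
pose x := y *m csec (f (i + 1)).
have yE : x *m C (i + 1) = y by rewrite -mulmxA csecK mulmx1.
have : (x *m cx_d X (i + 1) <= f (i + 1 + 1)%R)%MS.
  by rewrite -cproj_eq0 -mulmxA -quo_dE mulmxA yE dy.
case/submxP => w wE; exists (row_mx (- w) x); last first.
  by exists 0; rewrite mul0mx [X in X - _]mul_row_col mulmx0 add0r yE subrr.
have dw : w *m cx_d E (i + 1 + 1) = 0.
  apply: (row_free_inj (f_free (i + 1 + 1 + 1))) => /=.
  by rewrite -mulmxA (cm_comm f (i + 1 + 1)) mulmxA -wE -mulmxA cx_dd mulmx0 mul0mx.
rewrite [LHS]mul_row_block mulmx0 addr0 mulNmx mulmxN opprK mulNmx wE addNr dw.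
exact: row_mx0.
Qed.

Lemma K0_class_quo : K0_class quo = K0_class X - K0_class E.
Proof. exact: K0_class_cone quo_map_qis. Qed.

End Quotient.
End Triangles.

(** * Simple modules generate the Grothendieck group *)

Lemma row_free_bool (k : fieldType) (b : bool) d (M : 'M[k]_(b, d)) :
  (b -> M != 0) -> row_free M.
Proof.
case: b M => M M0; rewrite /row_free; first by rewrite rank_rV M0.
by rewrite -leqn0 rank_leq_row.
Qed.

Lemma const_mx1_free_full (k : fieldType) (a b : nat) : a = b -> (a <= 1)%N ->
  row_free (const_mx 1 : 'M[k]_(a, b)) /\ row_full (const_mx 1 : 'M[k]_(a, b)).
Proof.
move=> <-; case: a => [|[|//]] _; rewrite /row_free /row_full.
  by rewrite -leqn0 rank_leq_row.
have -> : const_mx 1 = 1%:M :> 'M[k]_1.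
  by apply/matrixP => i j; rewrite !ord1 !mxE eqxx.
by rewrite mxrank1.
Qed.

Section ScalarComplexes.
Variables (k : fieldType) (A : kalgebra k) (chi : {rmorphism A -> k}).
Hypothesis chi_scal : forall c, chi (kalg_in A c) = c.

Section Module.
Variable d : nat.

Definition scal_act (a : A) : 'M[k]_d := (chi a)%:M.

Lemma scal_act_is_zmod_morphism : zmod_morphism scal_act.
Proof. by move=> a b; rewrite /scal_act !raddfB. Qed.

Lemma scal_act_is_monoid_morphism : monoid_morphism scal_act.
Proof.
by split=> [|a b]; rewrite /scal_act ?rmorph1 // rmorphM -mulmxE scalar_mxM.
Qed.

HB.instance Definition _ := GRing.isZmodMorphism.Build A
  'M[k]_d scal_act scal_act_is_zmod_morphism.
HB.instance Definition _ := GRing.isMonoidMorphism.Build A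
  'M[k]_d scal_act scal_act_is_monoid_morphism.

Lemma scal_act_scal c : scal_act (kalg_in A c) = c%:M.
Proof. by rewrite /scal_act chi_scal. Qed.

Definition scal_mod : fdmod A := FdMod scal_act_scal.

End Module.

Section Complex.
Variables (d : int -> nat)
  (bdd : exists N : nat, forall i, (N < `|i|)%N -> d i = 0%N).

Definition scal_cplx : cplx A :=
  @Cplx _ _ (fun i => scal_mod (d i)) (fun i => 0)
    (fun i => @zero_hom _ _ (scal_mod (d i)) (scal_mod (d (i + 1))))
    (fun i => mulmx0 _ _) bdd.

End Complex.

Lemma stalk_bdd (N : int) :
  exists M : nat, forall i : int, (M < `|i|)%N -> (i == N) = 0%N :> nat.
Proof. by exists `|N|%N => i iN; case: eqP iN => // ->; rewrite ltnn. Qed.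

(** The dimension is the truth value of [i == N]; as the action is by scalars, no
    transport along [i = N] is needed. *)
Definition stalk (N : int) : cplx A := scal_cplx (stalk_bdd N).

Lemma nil_bdd : exists N : nat, forall i : int, (N < `|i|)%N -> 0%N = 0%N.
Proof. by exists 0%N. Qed.

Definition nil_cplx : cplx A := scal_cplx nil_bdd.

Section StalkShift.
Variable N : int.
Let f : cmap (stalk (N + 1)) nil_cplx := zero_map _ _.

Lemma stalk_shift_hom i : @is_hom _ _ (cone f i) (stalk N i) (const_mx 1).
Proof.
move=> a; rewrite /= /dsum_act /= /scal_act -scalar_mx_block.
by rewrite mul_scalar_mx mul_mx_scalar.
Qed.

Lemma stalk_shift_comm i :
  cx_d (cone f) i *m const_mx 1 = const_mx 1 *m cx_d (stalk N) i.
Proof. by rewrite /= /cone_d /= oppr0 block_mx0 mul0mx mulmx0. Qed.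

(** The cone of the zero map from a stalk to the zero complex is the shifted
    stalk. In each degree the two have the same dimension, 0 or 1, so the constant
    matrix 1 is an isomorphism between them. *)
Lemma K0_class_stalk_shift : K0_class (stalk N) = - K0_class (stalk (N + 1)).
Proof.
rewrite (@K0_class_cone _ _ _ _ _ f (CMap stalk_shift_hom stalk_shift_comm)).
  by rewrite (K0_class_zero (Z := nil_cplx)) // sub0r.
have e i : (fd_dim (cone f i) = (i == N))%N.
  by rewrite /= addn0 (inj_eq (addIr _)).
have e1 i : (fd_dim (cone f i) <= 1)%N by rewrite e; case: (i == N).
by apply: qis_bij => i; have [] := const_mx1_free_full k (e i) (e1 i).
Qed.

End StalkShift.

Section StalkInclusion.
Variables (X : cplx A) (N : int) (x : 'rV[k]_(fd_dim (X N))).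
Hypothesis x0 : x != 0.
Hypothesis x_eig : forall a, x *m fd_act (X N) a = chi a *: x.
Hypothesis X_top : fd_dim (X (N + 1)) = 0%N.

(** A family over all degrees through an eigenvector in degree [N]: its member of
    degree [i] is repeated on the [(i == N)] rows of the matrix of the inclusion,
    which gives a single formula in all degrees. *)
Lemma spread_vector : exists g : forall i, 'rV[k]_(fd_dim (X i)),
  g N != 0 /\ forall a, g N *m fd_act (X N) a = chi a *: g N.
Proof.
have h i : exists gi : 'rV[k]_(fd_dim (X i)),
    i = N -> gi != 0 /\ forall a, gi *m fd_act (X i) a = chi a *: gi.
  have [->|iN] := pselect (i = N); last by exists 0.
  by exists x => _; split.
exists (fun i => projT1 (boolp.cid (h i))).
by case: (boolp.cid (h N)) => /= g; apply.
Qed.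

(** As [X] vanishes in degree [N + 1], every vector of degree [N] is a cocycle, and
    a common eigenvector spans a subcomplex. *)
Lemma ex_stalk_inclusion : exists f : cmap (stalk N) X, forall i, row_free (f i).
Proof.
have [g [g0 g_eig]] := spread_vector.
pose F i : 'M[k]_(i == N, fd_dim (X i)) := \matrix_(a, b) g i 0 b.
have rowF i (a : 'I_(i == N)) : row a (F i) = g i.
  by apply/rowP => b; rewrite !mxE.
have iN i (a : 'I_(i == N)) : i = N by case: eqP a => // _ [].
have F_hom i : @is_hom _ _ (stalk N i) (X i) (F i).
  move=> a; rewrite /= /scal_act mul_scalar_mx; apply/row_matrixP => j.
  by rewrite row_mul linearZ /= rowF; have := iN _ j; move=> ij; subst i; rewrite g_eig.
have F_comm i : cx_d (stalk N) i *m F (i + 1) = F i *m cx_d X i.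
  rewrite /= mul0mx; apply/row_matrixP => j.
  by apply: mx_cols0; rewrite (iN _ j).
exists (CMap F_hom F_comm) => i /=; apply: row_free_bool => /eqP ij; subst i.
apply: contraNneq g0 => F0; apply/eqP/rowP => b; rewrite mxE.
have a : 'I_(N == N) by rewrite eqxx; exact: ord0.
by have /matrixP/(_ a b) := F0; rewrite !mxE.
Qed.

End StalkInclusion.

End ScalarComplexes.

Section Generation.
Variables (k : fieldType) (A : kalgebra k) (I : finType).
Variable chi : I -> {rmorphism A -> k}.
Hypothesis chi_scal : forall v c, chi v (kalg_in A c) = c.
Hypothesis ex_eig : forall M : fdmod A, fd_dim M <> 0%N -> exists v (y : 'rV_(fd_dim M)),
  y != 0 /\ forall a, y *m fd_act M a = chi v a *: y.

Definition simple v := stalk (chi_scal v) 0.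

Definition simple_span (t : {ffun I -> int}) : K0_Db A :=
  \sum_v K0_class (simple v) *~ t v.

Lemma simple_span_is_zmod_morphism : zmod_morphism simple_span.
Proof.
by move=> t u; rewrite /simple_span -sumrB; apply: eq_bigr => v _; rewrite !ffunE mulrzBr.
Qed.

HB.instance Definition _ := GRing.isZmodMorphism.Build _ _
  simple_span simple_span_is_zmod_morphism.

Definition spanned (z : K0_Db A) := exists t, simple_span t = z.

Lemma spannedB z w : spanned z -> spanned w -> spanned (z - w).
Proof. by move=> [t <-] [u <-]; exists (t - u); rewrite raddfB. Qed.

Lemma spanned0 : spanned 0.
Proof. by exists 0; rewrite raddf0. Qed.

Lemma spannedN z : spanned z -> spanned (- z).
Proof. by rewrite -sub0r; apply: spannedB; apply: spanned0. Qed.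

Lemma spannedD z w : spanned z -> spanned w -> spanned (z + w).
Proof. by move=> hz hw; rewrite -[w]opprK; apply/spannedB/spannedN. Qed.

Lemma spanned_stalk v N : spanned (K0_class (stalk (chi_scal v) N)).
Proof.
have up M : spanned (K0_class (stalk (chi_scal v) M)) <->
    spanned (K0_class (stalk (chi_scal v) (M + 1))).
  rewrite K0_class_stalk_shift; split=> /spannedN; by rewrite ?opprK.
have s0 : spanned (K0_class (stalk (chi_scal v) 0)).
  exists [ffun w => (w == v)%:R]; rewrite /simple_span (bigD1 v) //= ffunE eqxx.
  by rewrite big1 ?addr0 // => w wv; rewrite ffunE (negPf wv).
case: N => n; elim: n => [|n IH].
- exact: s0.
- by rewrite -addn1 PoszD -up.
- by rewrite up.
- by rewrite up (_ : Negz n.+1 + 1 = Negz n) //; lia.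
Qed.

(** The stalk spanned by an eigenvector in the highest nonzero degree splits off,
    and the quotient has smaller total dimension. The sum runs over the degrees
    from [-N] to [N], which contain all nonzero terms. *)
Lemma spanned_class (X : cplx A) : spanned (K0_class X).
Proof.
have [N hN] := cx_bdd X; pose dm (Y : cplx A) (j : nat) := fd_dim (Y (j%:Z - N%:Z)).
have [n] := ubnP (\sum_(j < N.*2.+1) dm X j)%N.
elim: n X hN => // n IH X hN; rewrite ltnS => sX.
have [X0|/existsNP[i Xi]] := pselect (forall i, fd_dim (X i) = 0%N).
  by rewrite K0_class_zero //; apply: spanned0.
have ltN j : fd_dim (X j) <> 0%N -> (`|j| <= N)%N.
  by move=> Xj; rewrite leqNgt; apply/negP => /hN.
have exP : exists j, dm X j != 0%N.
  exists (absz (i + N%:Z)); apply/eqP; rewrite /dm (_ : _ - _ = i) //.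
  by have := ltN _ Xi; lia.
have ubP j : dm X j != 0%N -> (j <= N.*2)%N.
  by move=> /eqP/ltN; lia.
have [j Xj jmax] := ex_maxnP exP ubP; set i0 := j%:Z - N%:Z.
have top : fd_dim (X (i0 + 1)) = 0%N.
  apply/eqP; apply: contraT => Xj1; have := jmax j.+1.
  by rewrite ltnn /dm (_ : _ - _ = i0 + 1) ?Xj1 /i0; [move/(_ isT)|lia].
have [v [y [y0 yE]]] := ex_eig (elimN eqP Xj).
have [f ff] := ex_stalk_inclusion (chi_scal v) y0 yE top.
have -> : K0_class X = K0_class (quo f) + K0_class (stalk (chi_scal v) i0).
  by rewrite K0_class_quo // subrK.
apply: spannedD (spanned_stalk _ _); apply: IH => [i' /hN Xi'|].
  by rewrite quo_dim // Xi'.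
apply: leq_trans sX; have jN : (j < N.*2.+1)%N by rewrite ltnS ubP.
rewrite [X in (_ < X)%N](bigD1 (Ordinal jN)) //= (bigD1 (Ordinal jN)) //=.
rewrite -addSn leq_add //.
  by rewrite /dm quo_dim //= eqxx subn1 prednK // lt0n.
by apply: leq_sum => a _; rewrite /dm quo_dim // leq_subr.
Qed.

End Generation.

(** * Euler characteristics cut out by an idempotent *)

Section Window.
Implicit Types (B : nat) (F G : int -> int).

(** The alternating sum of [F] over the degrees from [-B] to [B - 1]. It does not
    depend on [B] once [F] is supported there, and then shifting [F] changes its
    sign. *)
Definition window B F : int := \sum_(j < B.*2) (-1) ^+ (j + B) * F (j%:Z - B%:Z).

Definition supported B F := forall i, (B <= `|i|)%N -> F i = 0.

Lemma eq_window B F G : F =1 G -> window B F = window B G.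
Proof. by move=> e; apply: eq_bigr => j _; rewrite e. Qed.

Lemma windowD B F G : window B (fun i => F i + G i) = window B F + window B G.
Proof. by rewrite -big_split; apply: eq_bigr => j _; rewrite mulrDr. Qed.

Lemma window_shift B F : supported B F ->
  window B (fun i => F (i + 1)) = - window B F.
Proof.
case: B => [|B] sF; first by rewrite /window !big_ord0 oppr0.
rewrite /window doubleS big_ord_recr /= [in RHS]big_ord_recl /=.
rewrite sF; last by lia.
rewrite [in RHS]sF; last by lia.
rewrite !mulr0 addr0 add0r -sumrN; apply: eq_bigr => j _.
rewrite -mulNr /bump /= add1n addSn exprS mulN1r opprK; congr (_ * F _).
by lia.
Qed.

Lemma window_succ B F : supported B F -> window B.+1 F = window B F.
Proof.
move=> sF; rewrite /window doubleS big_ord_recl /= big_ord_recr /=.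
rewrite sF; last by lia.
rewrite sF; last by rewrite /bump; lia.
rewrite !mulr0 addr0 add0r; apply: eq_bigr => j _.
rewrite /bump /= add1n addnS addSn -addn2 exprD sqrrN expr1n mulr1.
by congr (_ * F _); lia.
Qed.

Lemma window_unique B C F : supported B F -> supported C F -> window B F = window C F.
Proof.
move=> sB sC; have mon D j : supported D F -> window (j + D) F = window D F.
  elim: j => // j IH sD; rewrite addSn window_succ ?IH // => i ji; apply: sD.
  by apply: leq_trans ji; rewrite leq_addl.
by rewrite -(mon B C) // addnC mon.
Qed.

End Window.

(** [hsec] and [hproj] identify the subquotient [Z / B] with a space of row vectors:
    the rows of [hsec] represent a basis of [Z / B] and [hproj] takes coordinates.
    They are locked to keep associativity from acting inside them. *)
HB.lock Definition hsec (k : fieldType) d (Z B : 'M[k]_d) :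
  'M[k]_(\rank (Z :\: B), d) := row_base (Z :\: B)%MS.

HB.lock Definition hproj (k : fieldType) d (Z B : 'M[k]_d) :
  'M[k]_(d, \rank (Z :\: B)) := proj_mx (Z :\: B)%MS B *m pinvmx (hsec Z B).

Section Subquotient.
Variables (k : fieldType) (d : nat) (Z B : 'M[k]_d).

Lemma hsec_sub : (hsec Z B <= Z)%MS.
Proof. by rewrite hsec.unlock eq_row_base diffmxSl. Qed.

Lemma hsecK : hsec Z B *m hproj Z B = 1%:M.
Proof.
rewrite hproj.unlock mulmxA proj_mx_id ?capmx_diff //.
  by apply: mulmxVp; rewrite hsec.unlock row_base_free.
by rewrite hsec.unlock eq_row_base.
Qed.

Lemma hproj0 p (z : 'M[k]_(p, d)) : (z <= B)%MS -> z *m hproj Z B = 0.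
Proof. by move=> zB; rewrite hproj.unlock mulmxA proj_mx_0 ?capmx_diff ?mul0mx. Qed.

(** Every cycle is homologous to its representative in the chosen complement. *)
Lemma hprojK p (z : 'M[k]_(p, d)) : (z <= Z)%MS ->
  (z - z *m hproj Z B *m hsec Z B <= B)%MS.
Proof.
move=> zZ; rewrite hproj.unlock mulmxA mulmxKpV; last first.
  by rewrite hsec.unlock eq_row_base proj_mx_sub.
apply: proj_mx_compl_sub; apply: submx_trans zZ _.
by rewrite -{1}(addsmx_diff_cap_eq Z B) addsmxS ?capmxSr.
Qed.

End Subquotient.

Section Homology.
Variables (k : fieldType) (A : kalgebra k) (e : A).
Hypothesis e_idem : e * e = e.
Implicit Types X Y Z : cplx A.

Definition idem_act X i := fd_act (X i) e.

Lemma idem_actK X i : idem_act X i *m idem_act X i = idem_act X i.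
Proof. by rewrite /idem_act mulmxE -rmorphM e_idem. Qed.

(** The part of the cocycles of degree [i + 1] on which [e] is the identity. *)
Definition cyc X (i : int) : 'M[k]_(fd_dim (X (i + 1))) :=
  (kermx (cx_d X (i + 1)) :&: idem_act X (i + 1)%R)%MS.

Definition bnd X (i : int) : 'M[k]_(fd_dim (X (i + 1))) :=
  <<idem_act X i *m cx_d X i>>%MS.

Lemma sub_idem_act X i p (z : 'M[k]_(p, _)) : (z <= idem_act X i)%MS = (z *m idem_act X i == z).
Proof.
apply/idP/eqP => [/submxP[w ->]|<-]; last exact: submxMl.
by rewrite -mulmxA idem_actK.
Qed.

Lemma sub_cyc X i p (z : 'M[k]_(p, _)) :
  (z <= cyc X i)%MS = (z *m cx_d X (i + 1) == 0) && (z *m idem_act X (i + 1) == z).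
Proof. by rewrite sub_capmx sub_kermx sub_idem_act. Qed.

Lemma sub_bnd X i p (z : 'M[k]_(p, _)) :
  reflect (exists2 w : 'M[k]_(p, _), w *m idem_act X i = w & z = w *m cx_d X i) (z <= bnd X i)%MS.
Proof.
rewrite genmxE; apply: (iffP submxP) => [[w ->]|[w we ->]].
  by exists (w *m idem_act X i); rewrite -!mulmxA ?idem_actK.
by exists w; rewrite mulmxA we.
Qed.

Lemma bnd_cyc X i : (bnd X i <= cyc X i)%MS.
Proof.
rewrite genmxE sub_cyc -mulmxA cx_dd mulmx0 eqxx /=; apply/eqP.
by rewrite -mulmxA -(@cx_hom _ _ X i e) mulmxA idem_actK.
Qed.

Definition hdim X i := \rank (cyc X i :\: bnd X i)%MS.

(** Rank-nullity on the image of [e]. In the alternating sum over all degrees the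
    last two ranks on the left cancel, which leaves the Euler characteristic. *)
Lemma hdimE X i :
  (hdim X i + \rank (idem_act X (i + 1) *m cx_d X (i + 1)) + \rank (idem_act X i *m cx_d X i) =
   \rank (idem_act X (i + 1)))%N.
Proof.
have h1 := mxrank_cap_compl (cyc X i) (bnd X i).
have h2 := mxrank_mul_ker (idem_act X (i + 1)) (cx_d X (i + 1)).
have c : \rank (idem_act X (i + 1)%R :&: kermx (cx_d X (i + 1)))%MS = \rank (cyc X i).
  by rewrite /cyc capmxC.
have b : \rank (cyc X i :&: bnd X i)%MS = \rank (idem_act X i *m cx_d X i).
  by rewrite (capmx_idPr (bnd_cyc X i)) genmxE.
rewrite -h2 c -h1 b /hdim addnAC [in RHS]addnC; congr addn.
by rewrite addnC.
Qed.

Section Map.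
Variables (X Y : cplx A) (f : cmap X Y) (i : int).

Lemma cyc_map p (z : 'M[k]_(p, _)) :
  (z <= cyc X i)%MS -> (z *m f (i + 1)%R <= cyc Y i)%MS.
Proof.
rewrite !sub_cyc => /andP[/eqP dz /eqP ez].
rewrite -!mulmxA -(cm_comm f (i + 1)) -(@cm_hom _ _ _ _ f (i + 1) e) !mulmxA.
by rewrite dz mul0mx eqxx /=; apply/eqP; rewrite [X in X *m _]ez.
Qed.

Lemma bnd_map p (z : 'M[k]_(p, _)) :
  (z <= bnd X i)%MS -> (z *m f (i + 1)%R <= bnd Y i)%MS.
Proof.
case/sub_bnd => w ew ->; apply/sub_bnd; exists (w *m f i).
  by rewrite -mulmxA -(@cm_hom _ _ _ _ f i e) mulmxA [X in X *m _]ew.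
by rewrite -!mulmxA (cm_comm f i).
Qed.

(** The map induced by [f] on the [e]-parts of cohomology, in the chosen bases. *)
Definition hmap : 'M[k]_(hdim X i, hdim Y i) :=
  hsec (cyc X i) (bnd X i) *m f (i + 1) *m hproj (cyc Y i) (bnd Y i).

End Map.

Lemma hmap_id X i : hmap (Defs.cid X) i = 1%:M.
Proof. by rewrite /hmap mulmx1 hsecK. Qed.

Lemma hmap_proj X Y (f : cmap X Y) i p (z : 'M[k]_(p, _)) : (z <= cyc X i)%MS ->
  z *m hproj (cyc X i) (bnd X i) *m hmap f i = z *m f (i + 1) *m hproj (cyc Y i) (bnd Y i).
Proof.
move=> zc; apply/eqP; rewrite eq_sym -subr_eq0 /hmap !mulmxA -mulmxBl -mulmxBl.
by apply/eqP/hproj0/bnd_map/hprojK.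
Qed.

Lemma hmap_comp X Y Z (f : cmap X Y) (g : cmap Y Z) i :
  hmap (ccomp f g) i = hmap f i *m hmap g i.
Proof.
rewrite {2}/hmap hmap_proj; last exact/cyc_map/hsec_sub.
by rewrite /hmap /= mulmxA.
Qed.

Lemma hmap_qis X Y (s : cmap X Y) i : qis s ->
  row_free (hmap s i) /\ row_full (hmap s i).
Proof.
move=> /(_ i)[inj surj]; split.
  rewrite -kermx_eq0 -submx0; apply/row_subP => j.
  have := sub_kermxP (row_sub j (kermx (hmap s i))); move: (row j _) => u su.
  pose z := u *m hsec (cyc X i) (bnd X i).
  have zc : (z <= cyc X i)%MS by apply: mulmx_sub; apply: hsec_sub.
  have szb : (z *m s (i + 1)%R <= bnd Y i)%MS.
    have zs0 : z *m s (i + 1) *m hproj (cyc Y i) (bnd Y i) = 0.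
      by rewrite -su /hmap /z !mulmxA.
    by have := hprojK (bnd Y i) (cyc_map s zc); rewrite zs0 mul0mx subr0.
  have /sub_bnd[w _ sz] := szb.
  move: (zc); rewrite sub_cyc => /andP[/eqP dz /eqP ez].
  have [|w' zE] := inj z dz; first by exists w.
  (* The [e]-part of a primitive of [z] is again a primitive of [z]. *)
  have zb : (z <= bnd X i)%MS.
    apply/sub_bnd; exists (w' *m idem_act X i); first by rewrite -mulmxA idem_actK.
    by rewrite -mulmxA (@cx_hom _ _ X i e) mulmxA -zE [RHS]ez.
  by rewrite -[u]mulmx1 -(hsecK (cyc X i) (bnd X i)) mulmxA hproj0 // sub0mx.
rewrite -sub1mx; apply/row_subP => j.
pose y := row j (hsec (cyc Y i) (bnd Y i)).
have yc : (y <= cyc Y i)%MS by apply: submx_trans (row_sub _ _) (hsec_sub _ _).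
move: (yc); rewrite sub_cyc => /andP[/eqP dy /eqP ey].
have [x dx [y' sx]] := surj y dy.
have xc : (x *m idem_act X (i + 1)%R <= cyc X i)%MS.
  rewrite sub_cyc -!mulmxA idem_actK (@cx_hom _ _ X (i + 1) e) mulmxA dx.
  by rewrite mul0mx !eqxx.
have -> : row j 1%:M = y *m hproj (cyc Y i) (bnd Y i).
  by rewrite -row_mul hsecK.
have : (x *m idem_act X (i + 1)%R *m s (i + 1)%R - y <= bnd Y i)%MS.
  apply/sub_bnd; exists (y' *m idem_act Y i); first by rewrite -mulmxA idem_actK.
  rewrite -!mulmxA (@cm_hom _ _ _ _ s (i + 1) e) (@cx_hom _ _ Y i e) !mulmxA.
  by rewrite -sx mulmxBl [y *m _]ey.
move/(hproj0 (cyc Y i)); rewrite mulmxBl -hmap_proj // => /eqP.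
by rewrite subr_eq0 => /eqP <-; apply: submxMl.
Qed.

(** The cohomology functor on the morphisms of the derived category. A formal
    inverse goes to a pseudo-inverse matrix, which is an inverse by [hmap_qis]. *)
Fixpoint dmap X Y (u : dhom X Y) i : 'M[k]_(hdim X i, hdim Y i) :=
  match u with
  | Dloc _ _ f => hmap f i
  | Dinv _ _ s _ => pinvmx (hmap s i)
  | Dcomp _ _ _ u v => dmap u i *m dmap v i
  end.

Lemma dmap_deq X Y (u v : dhom X Y) i : deq u v -> dmap u i = dmap v i.
Proof.
elim=> {X Y u v} //=.
- by move=> X Y u v w _ -> _ ->.
- by move=> X Y Z u u' v v' _ -> _ ->.
- by move=> *; rewrite mulmxA.
- by move=> *; rewrite hmap_id mul1mx.
- by move=> *; rewrite hmap_id mulmx1.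
- by move=> *; rewrite hmap_comp.
- by move=> X Y s qs; rewrite hmap_id mulmxVp //; case: (hmap_qis i qs).
- by move=> X Y s qs; rewrite hmap_id mulVpmx //; case: (hmap_qis i qs).
Qed.

Lemma hdim_diso X Y (u : dhom X Y) i : diso u -> hdim X i = hdim Y i.
Proof.
move=> [v [/(dmap_deq i)/= uv /(dmap_deq i)/= vu]].
rewrite hmap_id in uv; rewrite hmap_id in vu.
by apply/eqP; rewrite eqn_leq (mulmx1_min uv) (mulmx1_min vu).
Qed.

Definition cxbound X : nat := (projT1 (boolp.cid (cx_bdd X))).+1.

Lemma cxboundP X i : (cxbound X <= `|i|)%N -> fd_dim (X i) = 0%N.
Proof. by rewrite /cxbound; case: boolp.cid => N /= h; apply: h. Qed.

Definition euler X : int := window (cxbound X) (fun i => (\rank (idem_act X i))%:Z).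

Lemma rank_supported X B (r : int -> nat) : (cxbound X <= B)%N ->
  (forall i, r i <= fd_dim (X i))%N -> supported B (fun i => (r i)%:Z).
Proof.
move=> XB rX i iB; apply/eqP; rewrite eqz_nat -leqn0.
by apply: leq_trans (rX i) _; rewrite cxboundP // (leq_trans XB).
Qed.

Lemma eulerE X B : (cxbound X <= B)%N -> euler X = window B (fun i => (\rank (idem_act X i))%:Z).
Proof.
move=> XB; apply: window_unique; apply: rank_supported (fun i => rank_leq_row _) => //.
Qed.

(** [hdim X i] belongs to degree [i + 1], whence the sign. *)
Lemma euler_homology X B : (cxbound X <= B)%N ->
  euler X = - window B (fun i => (hdim X i)%:Z).
Proof.
move=> XB; have sE : supported B (fun i => (\rank (idem_act X i))%:Z).
  exact: rank_supported XB (fun i => rank_leq_row _).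
have sr : supported B (fun i => (\rank (idem_act X i *m cx_d X i))%:Z).
  by apply: rank_supported XB _ => i; apply: rank_leq_row.
rewrite (eulerE XB); apply: oppr_inj; rewrite opprK -(window_shift sE).
have -> : window B (fun i => (\rank (idem_act X (i + 1)))%:Z) =
    window B (fun i => (hdim X i)%:Z + ((\rank (idem_act X (i + 1) *m cx_d X (i + 1)))%:Z
      + (\rank (idem_act X i *m cx_d X i))%:Z)).
  by apply: eq_window => i; rewrite -(hdimE X i) !PoszD addrA.
by rewrite !windowD (window_shift sr) addNr addr0.
Qed.

Lemma euler_diso X Y (u : dhom X Y) : diso u -> euler X = euler Y.
Proof.
move=> uI; rewrite (euler_homology (leq_maxl (cxbound X) (cxbound Y))).
rewrite (euler_homology (leq_maxr (cxbound X) (cxbound Y))); congr (- _).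
by apply: eq_window => i; rewrite (hdim_diso i uI).
Qed.

(** In degree [i] the cone is the sum of the terms of degree [i + 1] of [X] and of
    degree [i] of [Y]. *)
Lemma euler_cone X Y (f : cmap X Y) : euler (cone f) = euler Y - euler X.
Proof.
pose B := maxn (maxn (cxbound X) (cxbound Y)) (cxbound (cone f)).
have [XB YB CB] : [/\ cxbound X <= B, cxbound Y <= B & cxbound (cone f) <= B]%N.
  by rewrite /B; split; lia.
rewrite (eulerE XB) (eulerE YB) (eulerE CB) -window_shift; last first.
  exact: rank_supported XB (fun i => rank_leq_row _).
rewrite addrC -windowD; apply: eq_window => i.
by rewrite /idem_act /= /dsum_act rank_diag_block_mx PoszD.
Qed.

Lemma euler_distinguished X Y Z u v w : @distinguished k A X Y Z u v w ->
  euler X - euler Y + euler Z = 0.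
Proof.
move=> [X' [Y' [f [a [b [c [[aI bI cI] _]]]]]]].
rewrite -(euler_diso aI) -(euler_diso bI) -(euler_diso cI) euler_cone.
by rewrite addrC subrKA subrr.
Qed.

Lemma euler_relation x : [set x : {freeg {classic cplx A} / int} |
    exists (X Y Z : {classic cplx A}) (u : dhom X Y) (v : dhom Y Z)
      (w : dhom Z (Defs.shift X)),
      distinguished u v w /\ x = << X >> - << Y >> + << Z >>] x -> 
  zlift (euler : {classic cplx A} -> int) x = 0.
Proof.
move=> [X [Y [Z [u [v [w [/euler_distinguished d ->]]]]]]].
by rewrite raddfD raddfB -d; congr (_ - _ + _); apply: zliftU.
Qed.

Definition K0_euler : {additive K0_Db A -> int} := zquot_lift euler_relation.

Lemma K0_euler_class X : K0_euler (K0_class X) = euler X.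
Proof. by rewrite /K0_class [LHS]zquot_lift_pi; apply: zliftU. Qed.

End Homology.

(** * The Grothendieck group is free on the vertices *)

Section K0Iso.
Variables (k : fieldType) (A : kalgebra k) (I : finType).
Variables (chi : I -> {rmorphism A -> k}) (e : I -> A).
Hypothesis chi_scal : forall v c, chi v (kalg_in A c) = c.
Hypothesis ex_eig : forall M : fdmod A, fd_dim M <> 0%N -> exists v (y : 'rV_(fd_dim M)),
  y != 0 /\ forall a, y *m fd_act M a = chi v a *: y.
Hypothesis e_idem : forall v, e v * e v = e v.
Hypothesis chi_e : forall v w, chi v (e w) = (w == v)%:R.

Lemma euler_simple v w : euler (e w) (simple chi_scal v) = (w == v)%:R.
Proof.
pose F (i : int) : int := ((i == 0) && (w == v))%:Z.
have FE i : (\rank (idem_act (e w) (simple chi_scal v) i))%:Z = F i.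
  rewrite /idem_act /= /scal_act chi_e /F; congr Posz.
  case: (w == v); rewrite ?andbT ?andbF; first by rewrite mxrank1.
  by rewrite raddf0 mxrank0.
rewrite /euler (eq_window _ FE); have -> : window (cxbound (simple chi_scal v)) F = window 1 F.
  apply: window_unique => i; last by case: i => [[|i]|i].
  by move/cxboundP => /=; rewrite /F; case: (i == 0).
have [F0 F1] : F (0%:Z - 1) = 0 /\ F (1%:Z - 1) = (w == v)%:R by rewrite /F; case: (w == v).
rewrite /window !big_ord_recr big_ord0 /= F0 F1 mulr0 !add0r.
by rewrite -signr_odd mul1r.
Qed.

Definition dimvect (x : K0_Db A) : {ffun I -> int} :=
  [ffun v => K0_euler (e_idem v) x].

Lemma dimvect_is_zmod_morphism : zmod_morphism dimvect.
Proof. by move=> x y; apply/ffunP => v; rewrite !ffunE raddfB. Qed.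

HB.instance Definition _ := GRing.isZmodMorphism.Build _ _
  dimvect dimvect_is_zmod_morphism.

Lemma dimvect_span : cancel (simple_span chi_scal) dimvect.
Proof.
move=> t; apply/ffunP => v; rewrite ffunE raddf_sum (bigD1 v) //= big1 => [|w wv].
  by rewrite raddfMz /= K0_euler_class euler_simple eqxx addr0 intz.
by rewrite raddfMz /= K0_euler_class euler_simple eq_sym (negPf wv) mul0rz.
Qed.

Lemma span_all (x : K0_Db A) : spanned chi_scal x.
Proof.
rewrite -(zpi_repr x); elim/freeg_ind_int: (repr x) => [|u v hu hv|X].
- by rewrite raddf0; apply: spanned0.
- by rewrite raddfB; apply: spannedB.
- exact: spanned_class.
Qed.

(** The simple modules generate, and their dimension vectors are the standard
    basis. *)
Lemma dimvect_bij : bijective dimvect.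
Proof.
exists (simple_span chi_scal); last exact: dimvect_span.
by move=> x; have [t <-] := span_all x; rewrite dimvect_span.
Qed.

End K0Iso.

Lemma K0_Lambda (k : fieldType) (r n m : nat) : (0 < n)%N ->
  exists g : {additive K0_Db (Lambda k r n m) -> {ffun 'I_(m + n) -> int}}, bijective g.
Proof.
move=> n0; exists (dimvect (@idem_idem k r n m)).
exact: (dimvect_bij (@lchar_scal k r n m) (fun M M0 => ex_eigenvector n0 M0)
  _ (@lchar_idem k r n m)).
Qed.

(** * Uniform continuity and lifting on a simplex *)

Section RealContinuity.
Variables (R : realType) (T : topologicalType).
Implicit Types f g : T -> R.

Lemma ctsC (c : R) : continuous (fun _ : T => c).
Proof. exact: cst_continuous. Qed.

Lemma ctsD f g : continuous f -> continuous g -> continuous (fun t => f t + g t).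
Proof. by move=> cf cg t; apply: continuousD; [apply: cf | apply: cg]. Qed.

Lemma ctsN f : continuous f -> continuous (fun t => - f t).
Proof. by move=> cf t; apply: continuousN; apply: cf. Qed.

Lemma ctsM f g : continuous f -> continuous g -> continuous (fun t => f t * g t).
Proof. by move=> cf cg t; apply: continuousM; [apply: cf | apply: cg]. Qed.

Lemma ctsV f : (forall t, f t != 0) -> continuous f -> continuous (fun t => (f t)^-1).
Proof. by move=> f0 cf t; apply: continuousV; [apply: f0 | apply: cf]. Qed.

Lemma ctsS (I : Type) (r : seq I) (F : I -> T -> R) : (forall i, continuous (F i)) ->
  continuous (fun t => \sum_(i <- r) F i t).
Proof.
move=> cF; elim: r => [|i r IH]; first by under eq_fun do rewrite big_nil; apply: ctsC.
by under eq_fun do rewrite big_cons; apply: ctsD.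
Qed.

Lemma cts_comp (U V : topologicalType) (h : U -> V) (f : T -> U) :
  continuous h -> continuous f -> continuous (fun t => h (f t)).
Proof. by move=> ch cf t; apply: continuous_comp; [apply: cf | apply: ch]. Qed.

End RealContinuity.

Section Simplex.
Variable R : realType.

Definition bary n (i : 'I_n.+1) (t : stdsimplex R n) : R := val t 0 i.

Lemma bary_cts n i : continuous (@bary n i).
Proof.
apply: (@cts_comp _ _ _ (fun M : 'rV[R]_n.+1 => M 0 i)).
  exact: coord_continuous.
exact: initial_continuous.
Qed.

Lemma bary_ge0 n (i : 'I_n.+1) (t : stdsimplex R n) : 0 <= bary i t.
Proof. by have [h _] := set_mem (valP t); apply: h. Qed.

Lemma sum_bary n (t : stdsimplex R n) : \sum_i bary i t = 1.
Proof. by have [_ h] := set_mem (valP t). Qed.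

Lemma bary_le1 n (i : 'I_n.+1) (t : stdsimplex R n) : bary i t <= 1.
Proof.
rewrite -(sum_bary t) (bigD1 i) //= lerDl; apply: sumr_ge0 => j _.
exact: bary_ge0.
Qed.

Lemma bary_inj n (t u : stdsimplex R n) : (forall i, bary i t = bary i u) -> t = u.
Proof. by move=> h; apply/val_inj/rowP => i; apply: h. Qed.

Lemma cts_to_simplex (T : topologicalType) n (f : T -> stdsimplex R n) :
  (forall i, continuous (fun t => bary i (f t))) -> continuous f.
Proof.
move=> cf; apply: continuous_comp_initial => t /= B [P Pn PB].
change (nbhs t [set s : T | B (val (f s))]).
suff : nbhs t [set s : T | forall j k, P j k (val (f s) j k)].
  by apply: filterS => s Ps; apply: PB => j k; apply: Ps.
apply: (@filter_forall _ _ (fun j => [set s : T |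
  forall k, P j k (val (f s) j k)]) (nbhs t)) => j.
apply: (@filter_forall _ _ (fun k => [set s : T |
  P j k (val (f s) j k)]) (nbhs t)) => k.
rewrite ord1 in Pn *; exact: (cf k t _ (Pn 0 k)).
Qed.

Definition mk_simplex n (c : 'I_n.+1 -> R) (h0 : forall i, 0 <= c i)
  (h1 : \sum_i c i = 1) : stdsimplex R n.
Proof.
exists (\row_i c i); apply/mem_set; split=> [i|]; first by rewrite mxE.
by rewrite -[RHS]h1; apply: eq_bigr => i _; rewrite mxE.
Defined.

Lemma bary_mk n c h0 h1 i : bary i (@mk_simplex n c h0 h1) = c i.
Proof. by rewrite /bary /= mxE. Qed.

(** The retraction of the line onto the unit interval. With it, convex combinations
    and heights are defined for all parameters, without side conditions. *)
Definition clamp (x : R) : R := Num.max 0 (Num.min 1 x).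

Lemma clamp_ge0 x : 0 <= clamp x.
Proof. by rewrite le_max lexx. Qed.

Lemma clamp_le1 x : clamp x <= 1.
Proof. by rewrite ge_max ler01 ge_min lexx. Qed.

Lemma clampE x : 0 <= x <= 1 -> clamp x = x.
Proof. by case/andP=> x0 x1; rewrite /clamp min_r // max_r. Qed.

Lemma clamp_cts : continuous clamp.
Proof.
move=> x; apply: continuous_max; first exact: cst_continuous.
by apply: continuous_min; [exact: cst_continuous | exact: cvg_id].
Qed.

Section Contraction.
Variable n : nat.

Definition contr_coord (s : R) (x : stdsimplex R n) (i : 'I_n.+1) : R :=
  (1 - clamp s) * (i == 0)%:R + clamp s * bary i x.

Lemma contr_coord_ge0 s x i : 0 <= contr_coord s x i.
Proof.
by rewrite addr_ge0 // mulr_ge0 ?subr_ge0 ?clamp_le1 ?ler0n ?clamp_ge0 ?bary_ge0.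
Qed.

Lemma contr_coord_sum s x : \sum_i contr_coord s x i = 1.
Proof.
rewrite big_split -!mulr_sumr sum_bary (bigD1 0) //= big1 => [|i /negPf-> //].
by rewrite addr0 !mulr1 subrK.
Qed.

(** The contraction of the simplex to its first vertex: [contr 0] is constant and
    [contr 1] is the identity. *)
Definition contr s x : stdsimplex R n :=
  mk_simplex (contr_coord_ge0 s x) (contr_coord_sum s x).

Lemma contr_cts s : continuous (contr s).
Proof.
apply: cts_to_simplex => i; under eq_fun do rewrite bary_mk.
apply: ctsD; first exact: ctsC.
by apply: ctsM; [exact: ctsC | exact: bary_cts].
Qed.

Lemma contr1 x : contr 1 x = x.
Proof.
apply: bary_inj => i; rewrite bary_mk /contr_coord clampE ?ler01 ?lexx //.
by rewrite subrr mul0r add0r mul1r.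
Qed.

Lemma contr0 x y : contr 0 x = contr 0 y.
Proof.
apply: bary_inj => i; rewrite !bary_mk /contr_coord clampE ?ler01 ?lexx //.
by rewrite !mul0r.
Qed.

Lemma contr_step s t x i : 0 <= s <= 1 -> 0 <= t <= 1 ->
  `|bary i (contr s x) - bary i (contr t x)| <= `|s - t|.
Proof.
move=> s01 t01; rewrite !bary_mk /contr_coord !clampE //.
have -> : (1 - s) * (i == 0)%:R + s * bary i x -
    ((1 - t) * (i == 0)%:R + t * bary i x) = (s - t) * (bary i x - (i == 0)%:R) by ring.
rewrite normrM ler_piMr // ler_norml; have := bary_ge0 i x; have := bary_le1 i x.
by case: (i == 0); rewrite ?subr0 ?mulr1n ?mulr0n => *; apply/andP; split; lra.
Qed.

End Contraction.

Lemma compact_simplex n : compact (stdsimplex R n).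
Proof.
have c1 : compact [set v : 'rV[R]_n.+1 | forall i, `[0, 1]%classic (v ord0 i)].
  apply: (@rV_compact R n.+1 (fun=> `[0, 1]%classic)) => i; exact: segment_compact.
have -> : stdsimplex R n = [set v : 'rV[R]_n.+1 | forall i, `[0, 1]%classic (v ord0 i)]
    `&` [set v | \sum_i v 0 i = 1].
  apply/seteqP; split=> v /= [h0 h1]; split=> // i; last first.
    by have := h0 i; rewrite in_itv /= => /andP[].
  by rewrite in_itv /= h0 -h1 (bigD1 i) //= lerDl sumr_ge0.
apply: compact_closedI c1 _.
apply: (@preimage_closed _ _ (fun v : 'rV[R]_n.+1 => \sum_i v 0 i) [set z : R | z = 1]);
  last exact: closed_eq.
move=> v _; apply: (@ctsS R _ _ _ (fun i (M : 'rV[R]_n.+1) => M 0 i)) => i.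
exact: coord_continuous.
Qed.

(** The simplex carries the topology induced from the sup norm. *)
Lemma nbhs_simplex n (x : stdsimplex R n) (U : set (stdsimplex R n)) : nbhs x U ->
  exists2 d : R, 0 < d & forall z, (forall i, `|bary i x - bary i z| < d) -> U z.
Proof.
case=> [/= _ [[W oW <-] Wx WU]].
have /nbhs_ballP[d /= d0 dW] : nbhs (val x) W by apply: open_nbhs_nbhs.
exists d => // z xz; apply: WU => /=; apply: dW; split=> // i j; rewrite ord1; exact: xz.
Qed.

(** Heine-Cantor, by compactness in its near-covering form: each point has a
    neighbourhood on which, for all small [d], the estimate holds. *)
Lemma unif_cts n (F : stdsimplex R n -> R) (eps : R) : continuous F -> 0 < eps ->
  exists2 d : R, 0 < d & forall y z, (forall i, `|bary i y - bary i z| < d) ->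
    `|F y - F z| < eps.
Proof.
move=> cF e0.
have /compact_near_coveringP/near_covering_withinP cov := @compact_simplex n.
pose P (d : R) (v : 'rV[R]_n.+1) := forall y z : stdsimplex R n, val y = v ->
  (forall i, `|bary i y - bary i z| < d) -> `|F y - F z| < eps.
have : \forall d \near (0:R)^'+, stdsimplex R n `<=` P d.
  apply: cov => x Kx; pose x' : stdsimplex R n := exist _ x (mem_set Kx).
  have [|d d0 dP] := @nbhs_simplex n x' [set z | `|F x' - F z| < eps / 2].
    have := cF x' _ (@nbhsx_ballx _ _ (F x') (eps / 2) _); apply; exact: divr_gt0.
  exists (ball x (d / 2), [set u : R | u < d / 2]).
    split; first by apply: nbhsx_ballx; apply: divr_gt0.
    by apply: nbhs_right_lt; apply: divr_gt0.
  move=> [v u] /= [[_ xv] ud] _ y z yv yz.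
  have xy i : `|bary i x' - bary i y| < d / 2.
    by have := xv 0 i; rewrite -yv.
  have Fy : `|F x' - F y| < eps / 2.
    by apply: dP => i; apply: lt_trans (xy i) _; lra.
  have Fz : `|F x' - F z| < eps / 2.
    apply: dP => i; rewrite -(subrKA (bary i y)); apply: le_lt_trans (ler_normD _ _) _.
    by rewrite [d]splitr; apply: ltrD; [apply: xy | apply: lt_trans (yz i) ud].
  rewrite -(subrKA (F x')); apply: le_lt_trans (ler_normD _ _) _.
  by rewrite [eps]splitr distrC; apply: ltrD.
move=> h; have [d [d0 dP]] := filter_ex (filterI (nbhs_right_gt (0:R)) h).
exists d => // y z; apply: dP => //; exact: set_mem (valP y).
Qed.

Lemma contr_fine n (d : R) : 0 < d -> exists N : nat, forall (x : stdsimplex R n) k i,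
  (k <= N)%N -> `|bary i (contr (k.+1%:R / N.+1%:R) x) -
                  bary i (contr (k%:R / N.+1%:R) x)| < d.
Proof.
move=> d0; have [N Nd] := filter_ex (near_infty_natSinv_lt (PosNum d0)).
exists N => x k i kN.
have frac j : (j <= N.+1)%N -> 0 <= (j%:R / N.+1%:R : R) <= 1.
  by move=> jN; rewrite divr_ge0 ?ler0n //= ler_pdivrMr ?ltr0n // mul1r ler_nat.
apply: le_lt_trans (contr_step x i (frac k.+1 kN) (frac k (leqW kN))) _.
by rewrite -mulrBl -natrB // subSnn mul1r gtr0_norm // invr_gt0 ltr0n.
Qed.

(** A function with values separated by gaps of size [eps] cannot move in a step of
    the contraction that changes it by less than [eps]; finitely many steps lead
    from any point to the first vertex. *)
Lemma discrete_cst n (F : stdsimplex R n -> R) (eps : R) : continuous F -> 0 < eps ->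
  (forall y z, `|F y - F z| < eps -> F y = F z) -> forall y z, F y = F z.
Proof.
move=> cF e0 disc; have [d d0 dF] := unif_cts cF e0; have [N fine] := contr_fine n d0.
have base x : F x = F (contr 0 x).
  suff h k : (k <= N.+1)%N -> F (contr (k%:R / N.+1%:R) x) = F (contr 0 x).
    by rewrite -{1}[x]contr1 -(h N.+1) // divff // pnatr_eq0.
  elim: k => [_|k IH kN]; first by rewrite mul0r.
  by apply: etrans (IH (ltnW kN)); apply: disc; apply: dF => i; apply: fine.
by move=> y z; rewrite base (base z) (contr0 y z).
Qed.

Lemma cos_sin_angle (a b : R) : 0 < a -> a ^+ 2 + b ^+ 2 = 1 ->
  cos (atan (b / a)) = a /\ sin (atan (b / a)) = b.
Proof.
move=> a0 ab; have an0 : a != 0 by rewrite gt_eqF.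
have cE : cos (atan (b / a)) = a.
  rewrite cos_atan; have -> : 1 + (b / a) ^+ 2 = (a ^+ 2 + b ^+ 2) / a ^+ 2 by field.
  rewrite ab mul1r.
  by rewrite -exprVn sqrtr_sqr gtr0_norm ?invr_gt0 // invrK.
split=> //; have := atanK (b / a); rewrite /tan cE => /(congr1 ( *%R^~ a)).
by rewrite !mulfVK.
Qed.

Lemma angle_exists (a b : R) : a ^+ 2 + b ^+ 2 = 1 ->
  exists t, cos t = a /\ sin t = b.
Proof.
move=> ab; have a1 : -1 <= a <= 1.
  by have := sqr_ge0 b; move=> ?; apply/andP; split; nra.
have sE : sin (acos a) = `|b|.
  by rewrite sin_acos // -sqrtr_sqr -ab addrAC subrr add0r.
have [b0|b0] := leP 0 b.
  by exists (acos a); rewrite acosK ?in_itv //= sE ger0_norm.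
by exists (- acos a); rewrite cosN sinN acosK ?in_itv //= sE ltr0_norm // opprK.
Qed.

(** Along the contraction, cut into steps so small that consecutive images on the
    circle have a positive scalar product, the angle between consecutive images is
    an arctangent depending continuously on the point; the lift is the sum of these
    angles. *)
Lemma lift_circle n (c d : stdsimplex R n -> R) : continuous c -> continuous d ->
  (forall t, c t ^+ 2 + d t ^+ 2 = 1) ->
  exists2 th : stdsimplex R n -> R, continuous th &
    forall t, cos (th t) = c t /\ sin (th t) = d t.
Proof.
move=> cc cd cd1; have [d1 d10 d1P] := unif_cts cc ltr01.
have [d2 d20 d2P] := unif_cts cd ltr01.
have [N fine] : exists N : nat, forall (x : stdsimplex R n) k i, (k <= N)%N ->
    `|bary i (contr (k.+1%:R / N.+1%:R) x) -
      bary i (contr (k%:R / N.+1%:R) x)| < Num.min d1 d2.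
  by apply: contr_fine; rewrite lt_min d10.
pose h k := contr (k%:R / N.+1%:R) : stdsimplex R n -> _.
have hc k : continuous (h k) by apply: contr_cts.
suff H k : (k <= N.+1)%N -> exists2 th : stdsimplex R n -> R, continuous th &
    forall t, cos (th t) = c (h k t) /\ sin (th t) = d (h k t).
  have [th cth thP] := H _ (leqnn _); exists th => // t; have := thP t.
  by rewrite /h divff ?pnatr_eq0 // contr1.
elim: k => [_|k IH kN].
  have t0 : stdsimplex R n.
    have [x0 x1] : (forall i : 'I_n.+1, 0 <= (i == 0)%:R :> R) /\
      \sum_(i < n.+1) (i == 0)%:R = 1 :> R.
      split=> [i|]; first exact: ler0n.
      by rewrite (bigD1 0) //= big1 ?addr0 // => i /negPf->.
    exact: mk_simplex x0 x1.
  have [a aP] := angle_exists (cd1 (h 0%N t0)); exists (fun _ => a); first exact: ctsC.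
  move=> t; have -> : h 0%N t = h 0%N t0 by rewrite /h mul0r; apply: contr0.
  exact: aP.
have [th cth thP] := IH (ltnW kN).
(* cosine and sine of the angle covered by the step number [k] *)
pose dot t := c (h k t) * c (h k.+1 t) + d (h k t) * d (h k.+1 t).
pose crs t := c (h k t) * d (h k.+1 t) - d (h k t) * c (h k.+1 t).
have dot0 t : 0 < dot t.
  have /ltr_normlP[c1 c2] : `|c (h k.+1 t) - c (h k t)| < 1.
    by apply: d1P => i; have := fine t k i kN; rewrite lt_min => /andP[].
  have /ltr_normlP[e1 e2] : `|d (h k.+1 t) - d (h k t)| < 1.
    by apply: d2P => i; have := fine t k i kN; rewrite lt_min => /andP[].
  by have := cd1 (h k t); have := cd1 (h k.+1 t); rewrite /dot; nra.
exists (fun t => th t + atan (crs t / dot t)).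
  apply: ctsD => //; apply: cts_comp; first exact: continuous_atan.
  have ch j : continuous (fun t => c (h j t)) by apply: cts_comp.
  have dh j : continuous (fun t => d (h j t)) by apply: cts_comp.
  apply: ctsM; first by apply: ctsD; [apply: ctsM|apply: ctsN; apply: ctsM].
  apply: ctsV => [t|]; first by rewrite gt_eqF.
  by apply: ctsD; apply: ctsM.
move=> t; have [cE sE] : cos (atan (crs t / dot t)) = dot t /\ sin (atan (crs t / dot t)) = crs t.
  apply: cos_sin_angle => //; have := cd1 (h k t); have := cd1 (h k.+1 t).
  rewrite /dot /crs; set a := c _; set b := d _; set a' := c _; set b' := d _ => h1 h2.
  by rewrite -[RHS](mulr1 1) -{1}h1 -h2; ring.
rewrite cosD sinD cE sE; have [-> ->] := thP t; have := cd1 (h k t).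
rewrite /dot /crs; set a := c _; set b := d _; set a' := c _; set b' := d _ => h1.
by split; rewrite -[RHS](mulr1) -h1; ring.
Qed.

End Simplex.

(** * The covering of the cylinder by the plane *)

Section Cylinder.
Variable R : realType.
Notation cylinder := (cylinder R).

Definition tau : R := pi *+ 2.

Lemma tau_gt0 : 0 < tau.
Proof. by rewrite /tau pmulrn_rgt0 ?pi_gt0. Qed.

Lemma cos_sin_tau (k : int) (x : R) :
  cos (x + k%:~R * tau) = cos x /\ sin (x + k%:~R * tau) = sin x.
Proof.
have nat_case n (y : R) : cos (y + n%:R * tau) = cos y /\ sin (y + n%:R * tau) = sin y.
  elim: n => [|n [IHc IHs]]; first by rewrite mul0r addr0.
  have -> : y + n.+1%:R * tau = (y + n%:R * tau) + tau by rewrite -natr1; ring.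
  by rewrite cosD2pi sinD2pi.
case: k => n; first exact: nat_case.
have := nat_case n.+1 (x + (Negz n)%:~R * tau).
by rewrite NegzE mulrNz mulNr subrK => -[-> ->].
Qed.

Lemma cos_sin_eq (a b : R) : cos a = cos b -> sin a = sin b ->
  exists k : int, a = b + k%:~R * tau.
Proof.
move=> ce se; pose k := Num.floor ((a - b) / tau); exists k.
pose x := (a - b) - k%:~R * tau.
have t0 := tau_gt0.
have /andP[] := real_floor_itv (num_real ((a - b) / tau)).
rewrite -/k ler_pdivlMr // ltr_pdivrMr // intrD mulrDl mul1r => k1 k2.
have x0 : 0 <= x by rewrite /x subr_ge0.
have xt : x < tau by rewrite /x; lra.
have cx : cos x = 1.
  rewrite /x -mulNr -mulrNz; have [-> _] := cos_sin_tau (- k) (a - b).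
  by rewrite cosB ce se -!expr2 cos2Dsin2.
suff x00 : x = 0 by rewrite /x in x00; lra.
have p0 := pi_ge0 R; have tp : tau = pi + pi by rewrite /tau mulr2n.
have [xp|xp] := leP x pi.
  by apply: (@cos_inj R); rewrite ?in_itv /= ?x0 ?xp ?lexx ?cos0.
have : tau - x = 0; last by lra.
apply: (@cos_inj R); rewrite ?in_itv /= ?lexx ?p0 ?cos0 //.
  by apply/andP; split; lra.
by rewrite addrC cosD2pi cosN.
Qed.

Definition circ (a : R) : circle R :=
  exist _ (cos a, sin a) (mem_set (cos2Dsin2 a : circle R (cos a, sin a))).

Lemma clamp_itv (b : R) : `[0%R, 1%R : R]%classic (clamp b).
Proof. by rewrite /= in_itv /= clamp_ge0 clamp_le1. Qed.

Definition level (b : R) : `[0%R, 1%R : R]%classic :=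
  exist _ (clamp b) (mem_set (clamp_itv b)).

(** The covering of the cylinder by the plane. Heights are clamped, so that it is
    defined on the whole plane. *)
Definition cyl (a b : R) : cylinder := (circ a, level b).

Definition height (z : cylinder) : R := val z.2.

Lemma height_itv z : 0 <= height z <= 1.
Proof. by have := set_mem (valP z.2); rewrite /= in_itv. Qed.

Lemma cyl_height z a : cos a = (val z.1).1 -> sin a = (val z.1).2 ->
  cyl a (height z) = z.
Proof.
move=> ca sa; case: z ca sa => z h /= ca sa; congr pair; apply: val_inj => /=.
  by rewrite ca sa; case: (val z).
by rewrite clampE // (height_itv (z, h)).
Qed.

Lemma circleP (z : circle R) : (val z).1 ^+ 2 + (val z).2 ^+ 2 = 1.
Proof. exact: (set_mem (valP z)). Qed.

Lemma ang_exists (z : cylinder) : exists a, cyl a (height z) = z.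
Proof.
have [a [ca sa]] := angle_exists (circleP z.1).
by exists a; apply: cyl_height.
Qed.

(** A discontinuous section of the covering of the circle, used as a reference to
    count turns. *)
Definition ang (z : cylinder) : R := projT1 (boolp.cid (ang_exists z)).

Lemma angK z : cyl (ang z) (height z) = z.
Proof. by rewrite /ang; case: boolp.cid. Qed.

Lemma cyl_shift (k : int) a b : cyl (a + k%:~R * tau) b = cyl a b.
Proof.
congr pair; apply: val_inj => /=; by have [-> ->] := cos_sin_tau k a.
Qed.

Lemma cyl_inj a b a' b' : cyl a b = cyl a' b' -> exists k : int, a = a' + k%:~R * tau.
Proof. by move=> [] ? ? _; apply: cos_sin_eq. Qed.

Lemma cts_cyl (T : topologicalType) (f g : T -> R) : continuous f -> continuous g ->
  continuous (fun t => cyl (f t) (g t)).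
Proof.
move=> cf cg t; apply: (@cvg_pair _ _ _ _ (nbhs (circ (f t))) (nbhs (level (g t)))).
  have cc : continuous (fun t => circ (f t)); last exact: cc.
  apply: continuous_comp_initial => {}t.
  apply: (@cvg_pair _ _ _ _ (nbhs (cos (f t))) (nbhs (sin (f t)))).
    have c : continuous (fun t => cos (f t)); last exact: c.
    by apply: cts_comp cf; apply: continuous_cos.
  have c : continuous (fun t => sin (f t)); last exact: c.
  by apply: cts_comp cf; apply: continuous_sin.
have cc : continuous (fun t => level (g t)); last exact: cc.
apply: continuous_comp_initial.
exact: (cts_comp (@clamp_cts R) cg).
Qed.

Lemma cts_fst1 : continuous (fun z : cylinder => (val z.1).1).
Proof.
apply: (@cts_comp _ _ _ (fun w : R * R => w.1)); first by move=> w; apply: cvg_fst.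
apply: (@cts_comp _ _ _ (fun w : circle R => val w)); first exact: initial_continuous.
by move=> w; apply: cvg_fst.
Qed.

Lemma cts_fst2 : continuous (fun z : cylinder => (val z.1).2).
Proof.
apply: (@cts_comp _ _ _ (fun w : R * R => w.2)); first by move=> w; apply: cvg_snd.
apply: (@cts_comp _ _ _ (fun w : circle R => val w)); first exact: initial_continuous.
by move=> w; apply: cvg_fst.
Qed.

Lemma cts_height : continuous height.
Proof.
apply: (@cts_comp _ _ _ (fun w : `[0%R, 1%R : R]%classic => val w)).
  exact: initial_continuous.
by move=> w; apply: cvg_snd.
Qed.

Section CylinderSimplex.
Variable n : nat.

(** The singular simplex of the cylinder with given lift to the plane. *)
Definition cyl_simplex (f g : stdsimplex R n -> R) (cf : continuous f) (cg : continuous g) :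
  simplex R cylinder n := mkcts (cts_cyl cf cg).

Lemma cyl_simplexE f g cf cg t : @cyl_simplex f g cf cg t = cyl (f t) (g t).
Proof. by []. Qed.

Lemma simplex_ext (X : topologicalType) (s s' : simplex R X n) : s =1 s' -> s = s'.
Proof. by move=> e; apply/continuousEP. Qed.

Lemma simplex_cts (X : topologicalType) (s : simplex R X n) : continuous s.
Proof. exact: cts_fun. Qed.

Lemma lift_simplex (s : simplex R cylinder n) :
  exists2 f : stdsimplex R n -> R, continuous f & forall t, s t = cyl (f t) (height (s t)).
Proof.
have [|||f cf fP] := @lift_circle R n (fun t => (val (s t).1).1) (fun t => (val (s t).1).2).
- exact: (cts_comp cts_fst1 (@simplex_cts _ s)).
- exact: (cts_comp cts_fst2 (@simplex_cts _ s)).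
- by move=> t; apply: circleP.
by exists f => // t; have [? ?] := fP t; rewrite cyl_height.
Qed.

End CylinderSimplex.

End Cylinder.

(** * Vertices, faces and winding numbers *)

Section Vertices.
Variable R : realType.

Lemma vertex_ge0 n (i j : 'I_n.+1) : 0 <= (j == i)%:R :> R.
Proof. exact: ler0n. Qed.

Lemma vertex_sum n (i : 'I_n.+1) : \sum_j (j == i)%:R = 1 :> R.
Proof. by rewrite (bigD1 i) //= eqxx big1 ?addr0 // => j /negPf->. Qed.

Definition vertex n (i : 'I_n.+1) : stdsimplex R n := mk_simplex (vertex_ge0 i) (vertex_sum i).

Lemma bary_vertex n (i j : 'I_n.+1) : bary j (vertex i) = (j == i)%:R.
Proof. exact: bary_mk. Qed.

Lemma bary_face n (i j : 'I_n.+2) (t : stdsimplex R n) :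
  bary j (face_map i t) = oapp (fun l => bary l t) 0 (unlift i j).
Proof. by rewrite /bary /= mxE. Qed.

(** Faces are indexed so that the face opposite to [i] skips the vertex [i]. *)
Lemma face_vertex n (i : 'I_n.+2) (j : 'I_n.+1) : face_map i (vertex j) = vertex (fintype.lift i j).
Proof.
apply: bary_inj => l; rewrite bary_face bary_vertex.
case: unliftP => [l' ->|->] /=; first by rewrite bary_vertex (inj_eq lift_inj).
by rewrite (negPf (neq_lift i j)).
Qed.

Lemma simplex0 (t u : stdsimplex R 0) : t = u.
Proof.
apply: bary_inj => i; have := sum_bary t; have := sum_bary u.
have -> : i = ord0 by apply: ord1.
by rewrite !big_ord1 => -> ->.
Qed.

(** The indices of the first three vertices, as ordinals in the form produced by
    [big_ord_recl]. *)
Definition i0 n : 'I_n.+1 := ord0.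
Definition i1 n : 'I_n.+2 := fintype.lift ord0 ord0.
Definition i2 n : 'I_n.+3 := fintype.lift ord0 (fintype.lift ord0 ord0).

Lemma lift3 : [/\ fintype.lift (i0 2) (i0 1) = i1 1, fintype.lift (i0 2) (i1 0) = i2 0,
  fintype.lift (i1 1) (i0 1) = i0 2, fintype.lift (i1 1) (i1 0) = i2 0 &
  fintype.lift (i2 0) (i0 1) = i0 2 /\ fintype.lift (i2 0) (i1 0) = i1 1].
Proof. by split; [| | | |split]; apply: val_inj. Qed.

Lemma bary2 (t : stdsimplex R 1) : bary (i0 1) t = 1 - bary (i1 0) t.
Proof.
by have := sum_bary t; rewrite !big_ord_recl big_ord0 addr0 /i0 /i1 => <-; ring.
Qed.

Lemma bary3 (t : stdsimplex R 2) :
  bary (i0 2) t = 1 - bary (i1 1) t - bary (i2 0) t.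
Proof.
have := sum_bary t; rewrite !big_ord_recl big_ord0 addr0 /i0 /i1 /i2 => <-.
by ring.
Qed.

Lemma bary_face3 (t : stdsimplex R 1) :
  [/\ bary (i1 1) (face_map (i0 2) t) = bary (i0 1) t,
      bary (i2 0) (face_map (i0 2) t) = bary (i1 0) t,
      bary (i1 1) (face_map (i1 1) t) = 0,
      bary (i2 0) (face_map (i1 1) t) = bary (i1 0) t &
      bary (i1 1) (face_map (i2 0) t) = bary (i1 0) t /\
      bary (i2 0) (face_map (i2 0) t) = 0].
Proof.
have [l1 l2 l3 l4 [l5 l6]] := lift3.
have bl i j : bary (fintype.lift i j) (face_map i t) = bary j t.
  by rewrite bary_face liftK.
have bn i : bary i (face_map i t) = 0 by rewrite bary_face unlift_none.
by split; [rewrite -l1|rewrite -l2| |rewrite -l4|split; [rewrite -l6|]].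
Qed.

Section Boundary.
Variable X : topologicalType.

Lemma bd1 (s : simplex R X 1) :
  bd (<< s >> : chain R X 1) = << face (i0 1) s >> - << face (i1 0) s >>.
Proof.
rewrite /bd liftU scale1r /bd_simplex !big_ord_recl big_ord0 addr0 /=.
by rewrite expr0 scale1r expr1 scaleN1r.
Qed.

Lemma bd2 (s : simplex R X 2) : bd (<< s >> : chain R X 2) =
  << face (i0 2) s >> - << face (i1 1) s >> + << face (i2 0) s >>.
Proof.
rewrite /bd liftU scale1r /bd_simplex !big_ord_recl big_ord0 addr0 /=.
by rewrite /bump /= expr0 scale1r expr1 scaleN1r -signr_odd expr0 scale1r addrA.
Qed.

End Boundary.
End Vertices.

Section Wind.
Variable R : realType.
Notation cylinder := (cylinder R).
Notation v0 := (vertex R (i0 1)).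
Notation v1 := (vertex R (i1 0)).
Notation tau := (tau R).

(** Two lifts of a path differ by a continuous function with values in the
    multiples of [tau], that is, by a constant. *)
Lemma turn_unique (f f' : stdsimplex R 1 -> R) : continuous f -> continuous f' ->
  (forall t, exists k : int, f t = f' t + k%:~R * tau) ->
  f v1 - f v0 = f' v1 - f' v0.
Proof.
move=> cf cf' ff'; suff h : f v1 - f' v1 = f v0 - f' v0 by lra.
apply: (@discrete_cst _ _ (fun t => f t - f' t) tau); last 2 first.
- exact: tau_gt0.
- move=> y z; have [k ->] := ff' y; have [l ->] := ff' z.
  rewrite ![_ + _ - f' _]addrAC !subrr !add0r -mulrBl -intrB normrM (gtr0_norm (tau_gt0 R)).
  rewrite -{2}[tau]mul1r ltr_pM2r ?tau_gt0 // -intr_norm (ltrz1 _) => kl.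
  by congr (_%:~R * _); lia.
by apply: ctsD => //; apply: ctsN.
Qed.

Lemma wind_exists (s : simplex R cylinder 1) : exists k : int,
  exists2 f : stdsimplex R 1 -> R, continuous f &
    (forall t, s t = cyl (f t) (height (s t))) /\
    f v1 - f v0 = ang (s v1) - ang (s v0) + k%:~R * tau.
Proof.
have [f cf fP] := lift_simplex s.
have h t : exists k : int, f t = ang (s t) + k%:~R * tau.
  by apply: (@cyl_inj _ _ (height (s t)) _ (height (s t))); rewrite -fP angK.
have [k0 e0] := h v0; have [k1 e1] := h v1.
by exists (k1 - k0), f => //; split=> //; rewrite e0 e1 intrB; ring.
Qed.

(** The number of turns of a path, relative to the angles that the section [ang]
    gives to its ends; it is an integer for paths that are not closed too. *)
Definition wind (s : simplex R cylinder 1) : int := projT1 (boolp.cid (wind_exists s)).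

Lemma windP (s : simplex R cylinder 1) (f : stdsimplex R 1 -> R) (g : stdsimplex R 1 -> R) :
  continuous f -> (forall t, s t = cyl (f t) (g t)) ->
  f v1 - f v0 = ang (s v1) - ang (s v0) + (wind s)%:~R * tau.
Proof.
move=> cf fP; rewrite /wind; case: boolp.cid => k [f' cf' [f'P <-]] /=.
apply: turn_unique => // t; apply: (@cyl_inj _ _ (g t) _ (height (s t))).
by rewrite -fP -f'P.
Qed.

Lemma wind_eq (s : simplex R cylinder 1) (f : stdsimplex R 1 -> R) (g : stdsimplex R 1 -> R)
    (k : int) :
  continuous f -> (forall t, s t = cyl (f t) (g t)) ->
  f v1 - f v0 = ang (s v1) - ang (s v0) + k%:~R * tau -> wind s = k.
Proof.
move=> cf fP; rewrite (windP cf fP) => /addrI/(mulIf (lt0r_neq0 (tau_gt0 R))).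
exact: intr_inj.
Qed.

(** All faces can be lifted by restricting one lift of the triangle, and the angle
    variations along the boundary of a triangle add up to zero. *)
Lemma wind_cocycle (T : simplex R cylinder 2) :
  wind (face (i0 2) T) - wind (face (i1 1) T) + wind (face (i2 0) T) = 0.
Proof.
have [f cf fP] := lift_simplex T.
have fi i := @windP (face i T) (fun t => f (face_map i t)) (fun t => height (T (face_map i t)))
  (cts_comp cf (@face_map_continuous R 1 i)) (fun t => fP _).
have [l1 l2 l3 l4 [l5 l6]] := lift3.
have := fi (i0 2); have := fi (i1 1); have := fi (i2 0).
rewrite /= !face_vertex l1 l2 l3 l4 l5 l6 => h2 h1 h0.
apply: (@intr_inj R); apply: (mulIf (lt0r_neq0 (tau_gt0 R))).
by rewrite mul0r intrD intrB !mulrDl mulNr; lra.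
Qed.

End Wind.

(** * Paths modulo boundaries *)

Section Straight.
Variable R : realType.
Notation cylinder := (cylinder R).
Notation v0 := (vertex R (i0 1)).
Notation v1 := (vertex R (i1 0)).
Notation tau := (tau R).

Definition bd_image : set (chain R cylinder 1) := [set c | exists d : chain R cylinder 2, c = bd d].

(** The class of a path in the group of 1-chains modulo boundaries. *)
Definition chain_cls (s : simplex R cylinder 1) : zquot bd_image :=
  zpi bd_image (<< s >> : {freeg _ / int}).

Lemma chain_cls_triangle (T : simplex R cylinder 2) :
  chain_cls (face (i1 1) T) = chain_cls (face (i2 0) T) + chain_cls (face (i0 2) T).
Proof.
have : zpi bd_image (bd << T >>) = 0 by apply: zpi0; exists << T >>.
rewrite bd2 raddfD raddfB -/(chain_cls _) -/(chain_cls _) -/(chain_cls _) => /eqP.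
by rewrite addrAC subr_eq0 addrC => /eqP.
Qed.

(** The image in the cylinder of the segment from [P] to [S] in the plane. *)
Definition seg (P S : R * R) : simplex R cylinder 1 :=
  cyl_simplex (ctsD (ctsM (@bary_cts R 1 (i0 1)) (@ctsC _ _ P.1))
              (ctsM (@bary_cts R 1 (i1 0)) (@ctsC _ _ S.1)))
        (ctsD (ctsM (@bary_cts R 1 (i0 1)) (@ctsC _ _ P.2))
              (ctsM (@bary_cts R 1 (i1 0)) (@ctsC _ _ S.2))).

Lemma segE P S t : seg P S t =
  cyl (bary (i0 1) t * P.1 + bary (i1 0) t * S.1)
      (bary (i0 1) t * P.2 + bary (i1 0) t * S.2).
Proof. by []. Qed.

Lemma cts_bary_scale n (i : 'I_n.+1) (c : R) : continuous (fun t => bary i t * c).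
Proof. by apply: ctsM; [apply: bary_cts | apply: ctsC]. Qed.

(** The three segments bound the image of an affine triangle. *)
Lemma seg_add P S W : chain_cls (seg P W) = chain_cls (seg P S) + chain_cls (seg S W).
Proof.
pose f (P1 S1 W1 : R) (t : stdsimplex R 2) :=
  bary (i0 2) t * P1 + bary (i1 1) t * S1 + bary (i2 0) t * W1.
have cf P1 S1 W1 : continuous (f P1 S1 W1).
  by apply: ctsD; [apply: ctsD|]; apply: cts_bary_scale.
pose T := cyl_simplex (cf P.1 S.1 W.1) (cf P.2 S.2 W.2).
have := chain_cls_triangle T; congr (_ = _ + _); congr chain_cls; apply: simplex_ext => t;
  have [h1 h2 h3 h4 [h5 h6]] := bary_face3 t; rewrite segE /= cyl_simplexE /f !bary3;
  rewrite ?h1 ?h2 ?h3 ?h4 ?h5 ?h6 bary2; congr cyl; ring.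
Qed.

Lemma seg_cst P : chain_cls (seg P P) = 0.
Proof. by have /eqP := seg_add P P P; rewrite -subr_eq0 opprD addNKr oppr_eq0 => /eqP. Qed.

Lemma point_of_subproof (x : R) :
  (forall i : 'I_2, 0 <= (if i == i0 1 then 1 - clamp x else clamp x)) /\
  \sum_(i < 2) (if i == i0 1 then 1 - clamp x else clamp x) = 1.
Proof.
split; last by rewrite !big_ord_recl big_ord0 /= addr0 subrK.
by move=> i; case: eqP => _; rewrite ?subr_ge0 ?clamp_le1 ?clamp_ge0.
Qed.

(** The point of the 1-simplex with second barycentric coordinate [x]. *)
Definition point_of (x : R) : stdsimplex R 1 :=
  mk_simplex (point_of_subproof x).1 (point_of_subproof x).2.

Lemma point_of_cts : continuous point_of.
Proof.
apply: cts_to_simplex => i; under eq_fun do rewrite bary_mk.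
case: eqP => _; last exact: clamp_cts.
by apply: ctsD; [apply: ctsC | apply: ctsN; apply: clamp_cts].
Qed.

Lemma point_of_bary t : point_of (bary (i1 0) t) = t.
Proof.
have c : clamp (bary (i1 0) t) = bary (i1 0) t by rewrite clampE ?bary_ge0 ?bary_le1.
apply: bary_inj => i; rewrite bary_mk c; case: eqP => [->|]; first by rewrite bary2.
case: i => [[|[|//]] hi] ne; first by case: ne; apply: val_inj.
by congr bary; apply: val_inj.
Qed.

Lemma point_of0 : point_of 0 = v0.
Proof. by rewrite -[RHS]point_of_bary bary_vertex. Qed.

Lemma point_of1 : point_of 1 = v1.
Proof. by rewrite -[RHS]point_of_bary bary_vertex. Qed.

Section Prism.
Variables (f g : stdsimplex R 1 -> R) (cf : continuous f) (cg : continuous g).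

(** At time [l], the straight-line homotopy from [h] to the affine function with the
    same end values. *)
Definition straight_htpy (h : stdsimplex R 1 -> R) (x l : R) : R :=
  (1 - l) * h (point_of x) + l * ((1 - x) * h v0 + x * h v1).

Lemma straight_htpy_cts h (x l : stdsimplex R 2 -> R) :
  continuous h -> continuous x -> continuous l ->
  continuous (fun t => straight_htpy h (x t) (l t)).
Proof.
move=> ch cx cl; apply: ctsD; apply: ctsM.
- by apply: ctsD; [apply: ctsC | apply: ctsN].
- by apply: cts_comp ch _; apply: cts_comp point_of_cts cx.
- exact: cl.
- apply: ctsD; (apply: ctsM; last exact: ctsC) => //.
  by apply: ctsD; [apply: ctsC | apply: ctsN].
Qed.

Let x1 (t : stdsimplex R 2) := bary (i1 1) t + bary (i2 0) t.
Let x1_cts : continuous x1.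
Proof. by apply: ctsD; apply: bary_cts. Qed.
Let x2_cts := @bary_cts R 2 (i2 0).

(** The square of the homotopy is cut along its diagonal into two triangles; besides
    the path, the segment and the diagonal, their edges are constant paths. *)
Lemma straighten : chain_cls (cyl_simplex cf cg) = chain_cls (seg (f v0, g v0) (f v1, g v1)).
Proof.
pose T1 := cyl_simplex (straight_htpy_cts cf x1_cts x2_cts) (straight_htpy_cts cg x1_cts x2_cts).
pose T2 := cyl_simplex (straight_htpy_cts cf x2_cts x1_cts) (straight_htpy_cts cg x2_cts x1_cts).
(* the common diagonal *)
have D : face (i1 1) T1 = face (i1 1) T2.
  apply: simplex_ext => t; have [h1 h2 h3 h4 [h5 h6]] := bary_face3 t.
  by rewrite /= !cyl_simplexE /x1 h3 h4 add0r.
have A1 : face (i2 0) T1 = cyl_simplex cf cg.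
  apply: simplex_ext => t; have [h1 h2 h3 h4 [h5 h6]] := bary_face3 t.
  by rewrite /= !cyl_simplexE /x1 h5 h6 addr0 /straight_htpy point_of_bary; congr cyl; ring.
have B1 : face (i0 2) T1 = seg (f v1, g v1) (f v1, g v1).
  apply: simplex_ext => t; have [h1 h2 h3 h4 [h5 h6]] := bary_face3 t.
  rewrite segE /= !cyl_simplexE /x1 h1 h2 bary2 subrK /straight_htpy point_of1 /=; congr cyl; ring.
have A2 : face (i2 0) T2 = seg (f v0, g v0) (f v0, g v0).
  apply: simplex_ext => t; have [h1 h2 h3 h4 [h5 h6]] := bary_face3 t.
  rewrite segE /= !cyl_simplexE /x1 h5 h6 bary2 addr0 /straight_htpy point_of0 /=; congr cyl; ring.
have B2 : face (i0 2) T2 = seg (f v0, g v0) (f v1, g v1).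
  apply: simplex_ext => t; have [h1 h2 h3 h4 [h5 h6]] := bary_face3 t.
  rewrite segE /= !cyl_simplexE /x1 h1 h2 bary2 subrK /straight_htpy /=; congr cyl; ring.
have := chain_cls_triangle T1; have := chain_cls_triangle T2.
by rewrite D A1 A2 B1 B2 !seg_cst add0r addr0 => -> ->.
Qed.

End Prism.

(** The class of the segment from the origin to the lift of [z] given by the
    section. *)
Definition base_path (z : cylinder) : zquot bd_image := chain_cls (seg (0, 0) (ang z, height z)).

Definition loop : simplex R cylinder 1 := seg (0, 0) (tau, 0).

Lemma seg_shift (k : int) P S : seg (P.1 + k%:~R * tau, P.2) (S.1 + k%:~R * tau, S.2) = seg P S.
Proof.
apply: simplex_ext => t; rewrite !segE /= -[RHS](cyl_shift k); congr cyl.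
by rewrite bary2; ring.
Qed.

(** Both sides are additive in [k]. *)
Lemma seg_loop (k : int) : chain_cls (seg (0, 0) (k%:~R * tau, 0)) = chain_cls loop *~ k.
Proof.
pose lam (l : int) := chain_cls (seg (0, 0) (l%:~R * tau, 0)).
have lamD l l' : lam (l + l') = lam l + lam l'.
  rewrite /lam (seg_add _ (l%:~R * tau, 0)); congr (_ + _).
  rewrite -(seg_shift l (0, 0)) /= add0r; congr (chain_cls (seg _ (_, _))).
  by rewrite intrD; ring.
have lam_zmod : zmod_morphism lam.
  by move=> l l'; apply/eqP; rewrite eq_sym subr_eq -lamD subrK.
pose lamA : {additive int -> zquot bd_image} :=
  HB.pack lam (GRing.isZmodMorphism.Build _ _ _ lam_zmod).
rewrite -[LHS]/(lamA k) -[k in LHS]intz raddfMz; congr (_ *~ k).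
by rewrite /= /lam mul1r.
Qed.

(** Lift the path and straighten it. The resulting segment is the difference of two
    segments from the origin to lifts of the ends, each of which is a base path
    preceded by a multiple of the loop. *)
Lemma path_clsE s :
  chain_cls s = base_path (s v1) - base_path (s v0) + chain_cls loop *~ wind s.
Proof.
have [f cf fP] := lift_simplex s.
have ch : continuous (fun t => height (s t)).
  exact: (cts_comp (@cts_height R) (@simplex_cts R 1 _ s)).
have h t : exists k : int, f t = ang (s t) + k%:~R * tau.
  by apply: (@cyl_inj _ _ (height (s t)) _ (height (s t))); rewrite -fP angK.
have [k0 e0] := h v0; have [k1 e1] := h v1.
have sE : s = cyl_simplex cf ch by apply: simplex_ext => t; rewrite cyl_simplexE -fP.
have wE : wind s = k1 - k0.
  by apply: (wind_eq cf fP); rewrite e0 e1 intrB; ring.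
(* the segment from the origin to the lift of [z] shifted by [k] turns *)
have aux z (k : int) : chain_cls (seg (0, 0) (ang z + k%:~R * tau, height z)) =
    base_path z + chain_cls loop *~ k.
  rewrite (seg_add _ (k%:~R * tau, 0)) seg_loop addrC; congr (_ + _).
  rewrite /base_path -(seg_shift k (0, 0)) /= add0r; congr (chain_cls (seg _ (_, _))).
rewrite {1}sE straighten wE mulrzBr e0 e1 addrACA -opprD -!aux.
apply/eqP; rewrite eq_sym subr_eq [X in _ == X]addrC; apply/eqP; exact: seg_add.
Qed.

Lemma face_at_end : face_map (i0 1) (vertex R ord0) = v1.
Proof. exact: face_vertex. Qed.

Lemma face_at_start : face_map (i1 0) (vertex R ord0) = v0.
Proof. by rewrite face_vertex; congr vertex; apply: val_inj. Qed.

Lemma chain_clsE (c : chain R cylinder 1) : zpi bd_image c =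
  zlift (fun p : simplex R cylinder 0 => base_path (p (vertex R ord0))) (bd c) +
  chain_cls loop *~ zlift (@wind R) c.
Proof.
elim/freeg_ind_int: c => [|c d hc hd|s].
- by rewrite !raddf0 addr0.
- rewrite !(raddfB (zpi bd_image), raddfB (@bd R cylinder 0)) !(raddfB (zlift _)).
  by rewrite [X in X - _]hc [X in _ - X]hd mulrzBr opprD addrACA.
- have -> : bd << s >> = << face (i0 1) s >> - << face (i1 0) s >> := bd1 s.
  rewrite (raddfB (zlift _)) [X in X - _]zliftU [X in _ - X]zliftU [X in _ *~ X]zliftU.
  rewrite -[LHS]/(chain_cls s) path_clsE.
  by rewrite /= face_at_end face_at_start.
Qed.

End Straight.

(** * First homology relative to finitely many points *)

Lemma finite_gap (R : realType) (I : finType) (a : I -> R) :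
  exists2 eps : R, 0 < eps & forall i j, `|a i - a j| < eps -> a i = a j.
Proof.
have h : \forall eps \near (0:R)^'+, forall i j, `|a i - a j| < eps -> a i = a j.
  apply: filter_forall => i; apply: filter_forall => j.
  have [->|ne] := eqVneq (a i) (a j); first by apply: nearW.
  have d0 : 0 < `|a i - a j| by rewrite normr_gt0 subr_eq0.
  apply: filterS (nbhs_right_lt d0) => e e1 e2.
  by have := lt_trans e1 e2; rewrite ltxx.
by have [eps [e0 eP]] := filter_ex (filterI (nbhs_right_gt (0:R)) h); exists eps.
Qed.

Section RelativeH1.
Variables (R : realType) (N : nat).
Notation cylinder := (cylinder R).
Variables (l : 'I_N.+1 -> cylinder).
Hypothesis l_inj : injective l.
Let A : set cylinder := range l.
Notation v0 := (vertex R (i0 1)).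
Notation v1 := (vertex R (i1 0)).

(** The three real coordinates of the path are continuous with finitely many values,
    hence constant. *)
Lemma finite_simplex_cst (s : simplex R cylinder 1) : range s `<=` A ->
  forall t u, s t = s u.
Proof.
move=> sA; have sl t : exists i, s t = l i.
  by have [|i _ <-] := sA (s t); [exists t | exists i].
have q_cst (q : cylinder -> R) : continuous q -> forall t u, q (s t) = q (s u).
  move=> cq; have [eps e0 gap] := finite_gap (fun i => q (l i)).
  apply: (@discrete_cst R 1 (fun t => q (s t)) eps) => //.
    exact: (cts_comp cq (@simplex_cts R 1 _ s)).
  by move=> y z; have [i ->] := sl y; have [j ->] := sl z; apply: gap.
move=> t u; have := q_cst _ (@cts_height R) t u.
have := q_cst _ (@cts_fst1 R) t u; have := q_cst _ (@cts_fst2 R) t u.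
rewrite /height; case: (s t) (s u) => [z h] [z' h'] /= e2 e1 e3.
congr pair; apply: val_inj => //.
by apply/eqP; rewrite /= -pair_eqE; apply/andP; split; apply/eqP.
Qed.

Definition end_count (s : simplex R cylinder 1) (j : 'I_N.+1) : int :=
  `[< s v1 = l j >]%:R - `[< s v0 = l j >]%:R.

(** The multiplicity of [l 0] in the boundary is determined by the others; its place
    is taken by the winding number. *)
Definition path_invariant (s : simplex R cylinder 1) : {ffun 'I_N.+1 -> int} :=
  [ffun j => if j == ord0 then wind s else end_count s j].

Definition chain_invariant : {additive chain R cylinder 1 -> {ffun 'I_N.+1 -> int}} :=
  zlift path_invariant.

Lemma chain_invariantU s : chain_invariant << s >> = path_invariant s.
Proof. exact: zliftU. Qed.

Lemma chain_invariant_sub c : @sub_simplices R cylinder A 1 c -> chain_invariant c = 0.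
Proof.
move=> [s [sA ->]]; rewrite chain_invariantU; have cst := finite_simplex_cst sA.
apply/ffunP => j; rewrite !ffunE /end_count (cst v1 v0) subrr; case: eqP => // _.
apply: (@wind_eq R s (fun _ => ang (s v0)) (fun _ => height (s v0))).
- exact: ctsC.
- by move=> t; rewrite angK.
- by rewrite (cst v1 v0) !subrr mul0r addr0.
Qed.

Lemma face_face (T : simplex R cylinder 2) :
  [/\ face (i0 2) T v0 = T (vertex R (i1 1)), face (i0 2) T v1 = T (vertex R (i2 0)),
      face (i1 1) T v0 = T (vertex R (i0 2)), face (i1 1) T v1 = T (vertex R (i2 0)) &
      face (i2 0) T v0 = T (vertex R (i0 2)) /\ face (i2 0) T v1 = T (vertex R (i1 1))].
Proof.
have [l1 l2 l3 l4 [l5 l6]] := lift3.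
by split; [| | | |split]; rewrite /= face_vertex ?l1 ?l2 ?l3 ?l4 ?l5 ?l6.
Qed.

Lemma chain_invariant_bd (c : chain R cylinder 2) : chain_invariant (bd c) = 0.
Proof.
elim/freeg_ind_int: c => [|c d hc hd|T].
- by rewrite !raddf0.
- by rewrite (raddfB (@bd R cylinder 1)) raddfB [X in X - _]hc [X in _ - X]hd subrr.
- have -> : bd << T >> = << face (i0 2) T >> - << face (i1 1) T >> + << face (i2 0) T >> := bd2 T.
  rewrite raddfD raddfB [X in X - _ + _]chain_invariantU [X in _ - X + _]chain_invariantU.
  rewrite [X in _ + X]chain_invariantU; apply/ffunP => j; rewrite !ffunE.
  case: eqP => _; first exact: wind_cocycle.
  by rewrite /end_count; have [-> -> -> -> [-> ->]] := face_face T; ring.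
Qed.

Definition rel_invariant : {additive rel_chain R A 1 -> {ffun 'I_N.+1 -> int}} :=
  zquot_lift chain_invariant_sub.

Definition cycle_invariant (z : ker (rel_bd R A 0)) : {ffun 'I_N.+1 -> int} :=
  rel_invariant (ker_val z).

Lemma cycle_invariant_is_zmod_morphism : zmod_morphism cycle_invariant.
Proof. by move=> x y; rewrite /cycle_invariant -raddfB. Qed.

HB.instance Definition _ := GRing.isZmodMorphism.Build _ _
  cycle_invariant cycle_invariant_is_zmod_morphism.

Lemma rel_bd_pi n (c : chain R cylinder n.+1) :
  rel_bd R A n (zpi _ c) = zpi (@sub_simplices R cylinder A n) (bd c).
Proof. exact: zquot_map_pi. Qed.

Lemma cycle_invariant_bd : forall z : ker (rel_bd R A 0),
  [set z : ker (rel_bd R A 0) | exists u, ker_val z = rel_bd R A 1 u] z -> cycle_invariant z = 0.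
Proof.
move=> z [u zE]; rewrite /cycle_invariant zE -(zpi_repr u) rel_bd_pi.
by rewrite [LHS]zquot_lift_pi chain_invariant_bd.
Qed.

Definition h1_invariant : {additive rel_homologyS R A 0 -> {ffun 'I_N.+1 -> int}} :=
  zquot_lift cycle_invariant_bd.

Lemma h1_invariant_pi z c : ker_val z = zpi _ c -> h1_invariant (zpi _ z) = chain_invariant c.
Proof.
move=> zE; apply: etrans (zquot_lift_pi _ _) _.
by change (rel_invariant (ker_val z) = chain_invariant c); rewrite zE; apply: zquot_lift_pi.
Qed.

Section Supported.
Let pt := vertex R (@ord0 0).
Let cnt j (p : simplex R cylinder 0) : int := `[< p pt = l j >]%:R.

Lemma count_bd (c : chain R cylinder 1) j : j != ord0 -> chain_invariant c j = zlift (cnt j) (bd c).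
Proof.
move=> /negPf j0; elim/freeg_ind_int: c => [|c d hc hd|s].
- by rewrite !raddf0 ffunE.
- by rewrite raddfB (raddfB (@bd R cylinder 0)) raddfB !ffunE hc hd.
- rewrite chain_invariantU ffunE j0.
  have -> : bd << s >> = << face (i0 1) s >> - << face (i1 0) s >> := bd1 s.
  rewrite (raddfB (zlift _)) [X in _ = X - _]zliftU [X in _ = _ - X]zliftU.
  by rewrite /cnt /= face_at_end face_at_start.
Qed.

Lemma deg_bd (c : chain R cylinder 1) :
  zlift (fun _ : simplex R cylinder 0 => 1 : int) (bd c) = 0.
Proof.
elim/freeg_ind_int: c => [|c d hc hd|s].
- by rewrite !raddf0.
- by rewrite (raddfB (@bd R cylinder 0)) raddfB [X in X - _]hc [X in _ - X]hd subrr.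
- have -> : bd << s >> = << face (i0 1) s >> - << face (i1 0) s >> := bd1 s.
  by rewrite (raddfB (zlift _)) [X in X - _]zliftU [X in _ - X]zliftU subrr.
Qed.

(** A 0-chain supported on the marked points is the sum of these points with their
    multiplicities. *)
Lemma sub_count (G : zmodType) (g : cylinder -> G) (b : chain R cylinder 0) :
  smallest (@subgroup (chain R cylinder 0)) (@sub_simplices R cylinder A 0) b ->
  zlift (fun p : simplex R cylinder 0 => g (p pt)) b = \sum_j g (l j) *~ zlift (cnt j) b.
Proof.
move: b; apply: smallest_subgroup_ind => [|b b' hb hb'|b [p [pA ->]]].
- by rewrite raddf0 big1 // => j _; rewrite raddf0 mulr0z.
- rewrite raddfB [X in X - _]hb [X in _ - X]hb' -sumrB.
  by apply: eq_bigr => j _; rewrite raddfB mulrzBr.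
- have [|i _ pi] := pA (p pt); first by exists pt.
  rewrite [LHS]zliftU (bigD1 i) //= big1 => [|j ji]; rewrite [X in _ *~ X]zliftU /cnt.
    by rewrite asboolT // addr0 pi.
  rewrite asboolF // -pi => /l_inj ij; by rewrite ij eqxx in ji.
Qed.

(** If all invariants vanish, the multiplicities of the points other than [l 0] in
    the boundary vanish, that of [l 0] vanishes by degree, so the chain has no
    boundary and no winding, and is a boundary. *)
Lemma h1_invariant_inj : injective h1_invariant.
Proof.
apply: additive_inj => x; rewrite -(zpi_repr x); move: (repr x) => {x} z.
pose c := repr (ker_val z); have zE : ker_val z = zpi _ c by rewrite zpi_repr.
rewrite (h1_invariant_pi zE) => c0; apply: zpi0.
have bc : smallest (@subgroup (chain R cylinder 0)) (@sub_simplices R cylinder A 0) (bd c).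
  have := valP z; rewrite /= zE unfold_in /= => /eqP.
  rewrite [LHS]rel_bd_pi -(raddf0 (zpi _)) => /zpi_eqP; by rewrite subr0.
have cnt0 j : zlift (cnt j) (bd c) = 0.
  have cj i : i != ord0 -> zlift (cnt i) (bd c) = 0.
    by move=> i0; rewrite -count_bd // c0 ffunE.
  have [->|/cj//] := eqVneq j ord0.
  have := sub_count (fun _ => 1 : int) bc; rewrite deg_bd (bigD1 ord0) //= big1 => [|i i0].
    by rewrite addr0 intz.
  by rewrite cj // mulr0z.
have : zpi (@bd_image R) c = 0.
  rewrite chain_clsE (sub_count (@base_path R) bc) big1 => [|j _].
    have -> : zlift (@wind R) c = chain_invariant c ord0.
      elim/freeg_ind_int: (c) => [|d e hd he|s].
      - by rewrite !raddf0 ffunE.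
      - by rewrite !raddfB !ffunE [X in X - _]hd [X in _ - X]he.
      - by rewrite [LHS]zliftU chain_invariantU ffunE eqxx.
    by rewrite c0 ffunE mulr0z addr0.
  by rewrite cnt0 mulr0z.
rewrite -(raddf0 (zpi _)) => /zpi_eqP; rewrite subr0.
have ind : forall c, smallest (@subgroup _) (@bd_image R) c -> exists d, c = bd d.
  apply: smallest_subgroup_ind => [|u v [d ->] [d' ->]|//].
    by exists 0; rewrite raddf0.
  by exists (d - d'); rewrite raddfB.
move=> /ind[d cE]; exists (zpi _ d); rewrite rel_bd_pi -cE; exact: zE.
Qed.

End Supported.

(** The relative cycles on which the invariants take the values of the standard
    basis: the loop, and a path without winding from [l 0] to [l j]. *)
Definition edge (j : 'I_N.+1) : simplex R cylinder 1 :=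
  if j == ord0 then loop R
  else seg (ang (l ord0), height (l ord0)) (ang (l j), height (l j)).

Lemma seg_ends P S : seg P S v0 = cyl P.1 P.2 /\ seg P S v1 = cyl S.1 S.2.
Proof.
by rewrite !segE !bary_vertex /= !mul1r !mul0r !addr0 !add0r.
Qed.

Lemma seg_ang_ends z z' : seg (ang z, height z) (ang z', height z') v0 = z /\
  seg (ang z, height z) (ang z', height z') v1 = z'.
Proof. by have [-> ->] := seg_ends (ang z, height z) (ang z', height z'); rewrite !angK. Qed.

Lemma path_invariant_edge j : path_invariant (edge j) = [ffun i => (i == j)%:R].
Proof.
have tau1 : cyl (tau R) 0 = cyl 0 0 :> cylinder.
  by rewrite -(cyl_shift 1 0 0) add0r mul1r.
have segf (P S : R * R) t : seg P S t = cyl (bary (i0 1) t * P.1 + bary (i1 0) t * S.1)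
   (bary (i0 1) t * P.2 + bary (i1 0) t * S.2) by apply: segE.
have cf P S : continuous (fun t : stdsimplex R 1 => bary (i0 1) t * P + bary (i1 0) t * S).
  by apply: ctsD; apply: cts_bary_scale.
apply/ffunP => i; rewrite !ffunE /edge; case: (eqVneq j ord0) => [->|j0].
  have [e0 e1] := seg_ends (0, 0) (tau R, 0).
  case: eqP => [_|ne].
    apply: (@wind_eq R (seg (0, 0) (tau R, 0)) _ _ _ (cf _ _) (segf (0, 0) (tau R, 0))).
    by rewrite -[seg _ _]/(loop R) in e0 e1 *; rewrite e0 e1 /= tau1 !bary_vertex /=; ring.
  by rewrite /end_count e0 e1 /= tau1 subrr.
have [e0 e1] := seg_ang_ends (l ord0) (l j).
case: eqP => [->|/eqP ne].
  rewrite eq_sym (negPf j0).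
  apply: (wind_eq (cf _ _) (segf (ang (l ord0), height (l ord0)) (ang (l j), height (l j)))).
  by rewrite e0 e1 !bary_vertex /=; ring.
have lE a b : `[< l a = l b >] = (a == b).
  by apply/asboolP/eqP => [/l_inj|->].
by rewrite /end_count e0 e1 !lE (eq_sym ord0) (negPf ne) subr0 eq_sym.
Qed.

Lemma edge_cycle j : zpi (@sub_simplices R cylinder A 0) (bd << edge j >>) = 0.
Proof.
have -> : bd << edge j >> = << face (i0 1) (edge j) >> - << face (i1 0) (edge j) >>.
  exact: bd1.
rewrite /edge; case: (eqVneq j ord0) => [_|j0].
  have -> : face (i0 1) (loop R) = face (i1 0) (loop R); last by rewrite subrr raddf0.
  apply: simplex_ext => t; rewrite (simplex0 t (vertex R ord0)) /= face_at_end face_at_start.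
  have [-> ->] := seg_ends (0, 0) (tau R, 0).
  by rewrite -(cyl_shift 1 0 0) add0r mul1r.
have [e0 e1] := seg_ang_ends (l ord0) (l j).
rewrite raddfB; apply/eqP; rewrite subr_eq0; apply/eqP.
have in_A i : face i (seg (ang (l ord0), height (l ord0)) (ang (l j), height (l j)))
    (vertex R ord0) \in A -> zpi (@sub_simplices R cylinder A 0)
    << face i (seg (ang (l ord0), height (l ord0)) (ang (l j), height (l j))) >> = 0.
  move=> /set_mem iA; apply: zpi0; eexists; split; last reflexivity.
  by move=> _ [t _ <-]; rewrite (simplex0 t (vertex R ord0)).
apply: etrans (in_A _ _) (esym (in_A _ _)); apply/mem_set.
  by exists j => //=; rewrite face_at_end -[LHS]e1.
by exists ord0 => //=; rewrite face_at_start -[LHS]e0.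
Qed.

Lemma h1_invariant_bij : bijective h1_invariant.
Proof.
apply: bij_inj_surj; first exact: h1_invariant_inj.
move=> t; pose c : chain R cylinder 1 := \sum_j << edge j >> *~ t j.
have zc : (zpi (@sub_simplices R cylinder A 1) c) \in ker_pred (rel_bd R A 0).
  rewrite unfold_in rel_bd_pi /c !raddf_sum; apply/eqP/big1 => j _.
  transitivity (zpi (@sub_simplices R cylinder A 0) (bd << edge j >>) *~ t j).
    by rewrite !raddfMz.
  by rewrite edge_cycle mul0rz.
exists (zpi _ (Ker zc)); rewrite (@h1_invariant_pi _ c) // /c raddf_sum.
apply/ffunP => i; rewrite sum_ffunE (bigD1 i) //= big1 => [|j ji].
  by rewrite raddfMz chain_invariantU path_invariant_edge addr0 ffunMzE ffunE eqxx intz.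
by rewrite raddfMz chain_invariantU path_invariant_edge ffunMzE ffunE eq_sym (negPf ji) mul0rz.
Qed.

End RelativeH1.

(** * The isomorphism *)

Lemma relative_H1 (R : realType) (M : nat) (l : 'I_M -> cylinder R) :
  (0 < M)%N -> injective l ->
  exists h : {additive rel_homologyS R (range l) 0 -> {ffun 'I_M -> int}}, bijective h.
Proof.
by case: M l => // N l _ l_inj; exists (h1_invariant l); apply: h1_invariant_bij.
Qed.

(** The two families lie on different boundary circles, so the marked points are
    [p + q] distinct points. *)
Lemma marked_range (R : realType) (p q : nat) (x : 'I_p -> circle R) (y : 'I_q -> circle R) :
  injective x -> injective y ->
  exists2 l : 'I_(p + q) -> cylinder R, injective l & marked x y = range l.
Proof.
move=> x_inj y_inj.
have [l0 l1] : val (level (0 : R)) = 0 /\ val (level (1 : R)) = 1.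
  by rewrite /= !clampE ?lexx ?ler01.
pose l (i : 'I_(p + q)) : cylinder R := match fintype.split i with
  | inl a => (x a, level 0) | inr b => (y b, level 1) end.
have lx a : l (lshift q a) = (x a, level 0).
  by rewrite /l (unsplitK (inl a : 'I_p + 'I_q)).
have ly b : l (rshift p b) = (y b, level 1).
  by rewrite /l (unsplitK (inr b : 'I_p + 'I_q)).
have level_neq (u v : circle R) : (u, level 0) = (v, level 1) :> cylinder R -> False.
  move=> /(congr1 (fun c : cylinder R => val c.2)); rewrite [LHS]l0 [RHS]l1 => /eqP.
  by rewrite eq_sym oner_eq0.
exists l => [i j|].
  case: (split_ordP i) => a ->; case: (split_ordP j) => b ->; rewrite ?lx ?ly.
  - by case=> /x_inj ->.
  - by move/level_neq.
  - by move/esym/level_neq.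
  - by case=> /y_inj ->.
apply/seteqP; split=> [[c h] [[i [/= -> h0]]|[j [/= -> h1]]]|_ [i _ <-]].
- by exists (lshift q i) => //; rewrite lx; congr pair; apply: val_inj; rewrite [LHS]l0.
- by exists (rshift p j) => //; rewrite ly; congr pair; apply: val_inj; rewrite [LHS]l1.
- case: (split_ordP i) => a ->; rewrite ?lx ?ly; [left | right]; exists a; by split.
Qed.

Lemma additive_bij_comp_inv (G H K : zmodType) (g : {additive G -> K}) (h : {additive H -> K}) :
  bijective g -> bijective h -> exists f : {additive G -> H}, bijective f.
Proof.
move=> g_bij [h' hK h'K]; have h'_zmod : zmod_morphism h'.
  by move=> u v; apply: (can_inj hK); rewrite raddfB !h'K.
pose h'A : {additive K -> H} := HB.pack h' (GRing.isZmodMorphism.Build _ _ _ h'_zmod).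
exists (h'A \o g : {additive G -> H}); apply: bij_comp g_bij.
by exists h.
Qed.

Theorem proposition7p7 (k : closedFieldType) (R : realType) (r n m : nat)
    (x : 'I_(m + r) -> circle R) (y : 'I_(n - r) -> circle R) :
  (1 <= r)%N -> (r < n)%N -> injective x -> injective y ->
  exists f : {additive K0_Db (Lambda k r n m) -> rel_homologyS R (marked x y) 0},
    bijective f.
Proof.
move=> r1 rn x_inj y_inj.
have [l l_inj ->] := marked_range x_inj y_inj.
have e : (m + n = (m + r) + (n - r))%N by lia.
have [g g_bij] := K0_Lambda k r m (leq_ltn_trans (leq0n r) rn).
move: g g_bij; rewrite e => g g_bij.
have [|h h_bij] := relative_H1 _ l_inj; first by lia.
exact: additive_bij_comp_inv g_bij h_bij.
Qed.
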